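(* For every finite graph $G$, either $\gamma_G(n)=\Theta(n)$ or $\gamma_G(n)=O(\log(n))$. Moreover, there exists a finite graph $K$ such that $\gamma_K(n)=\Theta(\log(n))$.
   Context: Graphs are undirected, connected, without multiple edges, self-loops allowed; $V_G$, $E_G$ are the sets of vertices and edges of $G$. Hom shift: for a finite graph $G$, $X_G\subset V_G^{\mathbb Z^2}$ is the set of all $x$ such that $x_{\mathbf u}$ and $x_{\mathbf v}$ are neighbors in $G$ (i.e. $(x_{\mathbf u},x_{\mathbf v})\in E_G$) whenever $\mathbf u,\mathbf v\in\mathbb Z^2$ are nearest neighbors in the grid ($\|\mathbf u-\mathbf v\|_1=1$). It is a shift: a closed subset of $V_G^{\mathbb Z^2}$ invariant under translations. Block gluing: $\mathbb N=\{0,1,2,\dots\}$, $\mathbb N^*=\{1,2,\dots\}$. A block pattern of size $n\ge 1$ is an element of $\mathcal A^{\{0,\dots,n-1\}^2}$; it is globally admissible for a shift $X\subset\mathcal A^{\mathbb Z^2}$ if it appears (at some position) in some element of $X$. For $\mathbb U,\mathbb U'\subset\mathbb Z^2$, $\delta(\mathbb U,\mathbb U')=\min_{\mathbf u\in\mathbb U,\mathbf u'\in\mathbb U'}\|\mathbf u-\mathbf u'\|_\infty$. For $f:\mathbb N^*\to\mathbb N$ and $k\in\mathbb N^*$, $X$ is $(f,k)$-phased block gluing if for all $n\ge1$, all globally admissible block patterns $p,p'$ of the same size $n$, and all $\mathbf u,\mathbf u'\in\mathbb Z^2$ with $\delta(\mathbf u+\{0,\dots,n-1\}^2,\mathbf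 u'+\{0,\dots,n-1\}^2)\ge f(n)$, there exist $x\in X$ and $\mathbf v\in\mathbb Z^2$ with $\|\mathbf v\|_\infty<k$ such that $x$ restricted to $\mathbf u+\{0,\dots,n-1\}^2$ is $p$ and $x$ restricted to $\mathbf u'+\mathbf v+\{0,\dots,n-1\}^2$ is $p'$. For every finite (connected) $G$, $X_G$ is $(f,k)$-phased block gluing for some $(f,k)$. The phase $\theta_X$ is the minimal $k$ such that $X$ is $(f,k)$-phased block gluing for some $f$, and $\gamma_X:\mathbb N^*\to\mathbb N$ is the (pointwise) minimal function such that $X$ is $(\gamma_X,\theta_X)$-phased block gluing. Write $\gamma_G:=\gamma_{X_G}$. Asymptotics: $g(n)=O(f(n))$ means there are $c>0$, $K>0$ with $g(n)\le c f(n)+K$ for all $n\ge1$; $g(n)=\Theta(f(n))$ means $g(n)=O(f(n))$ and $f(n)=O(g(n))$. *)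

(* Defs.v *)
From mathcomp Require Import all_boot all_order all_algebra.
From mathcomp Require Import boolp classical_sets reals exp.

Set Implicit Arguments.
Unset Strict Implicit.
Unset Printing Implicit Defensive.
Import Order.TTheory GRing.Theory Num.Theory.

Local Open Scope classical_set_scope.
Local Open Scope ring_scope.

(* A [rel] has no multiple edges, and a loop at u is [edge u u]. *)
Record fin_graph := FinGraph {
  vertex :> finType;
  edge : rel vertex;
  edge_sym : symmetric edge;
  edge_connected : forall u v : vertex, connect edge u v
}.

Definition Z2 : zmodType := (int * int)%type.

Definition norm1 (u : Z2) : nat := (`|u.1| + `|u.2|)%N.
Definition norm_inf (u : Z2) : nat := maxn `|u.1|%N `|u.2|%N.

Definition hom_shift (G : fin_graph) : set (Z2 -> G) :=
  [set x | forall u v : Z2, norm1 (u - v) = 1%N -> edge (x u) (x v)].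

Arguments hom_shift G : clear implicits.

(* The minimum of a set of naturals; the value 0 for the empty set is junk. *)
Definition nat_min (P : set nat) : nat :=
  if pselect (exists n, `[< P n >]) is left exP then ex_minn exP else 0%N.

Lemma nat_minP (P : set nat) : P !=set0 ->
  P (nat_min P) /\ forall n, P n -> (nat_min P <= n)%N.
Proof.
case=> n0 Pn0; rewrite /nat_min; case: pselect => [exP | []]; last first.
  by exists n0; apply/asboolP.
case: ex_minnP => m /asboolP Pm min_m; split=> // n Pn.
by apply: min_m; apply/asboolP.
Qed.

Definition delta (U U' : set Z2) : nat :=
  nat_min [set norm_inf (u - u') | u in U & u' in U'].

Section Gluing.
Variable A : finType.

Definition pattern (n : nat) := {ffun 'I_n * 'I_n -> A}.

Definition cell n (i : 'I_n * 'I_n) : Z2 := (Posz i.1, Posz i.2).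

(* u + {0, ..., n-1}^2 *)
Definition block (n : nat) (u : Z2) : set Z2 :=
  range (fun i : 'I_n * 'I_n => u + cell i).

Definition appears_at n (p : pattern n) (x : Z2 -> A) (u : Z2) : Prop :=
  forall i : 'I_n * 'I_n, x (u + cell i) = p i.

Definition globally_admissible (X : set (Z2 -> A)) n (p : pattern n) : Prop :=
  exists x u, X x /\ appears_at p x u.

(* A function on the positive integers is represented by a function on nat
   whose value at 0 is never used. *)
Definition phased_block_gluing (X : set (Z2 -> A)) (f : nat -> nat) (k : nat)
    : Prop :=
  forall n : nat, (0 < n)%N -> forall p p' : pattern n,
    globally_admissible X p -> globally_admissible X p' ->
  forall u u' : Z2, (f n <= delta (block n u) (block n u'))%N ->
  exists x v, [/\ X x, (norm_inf v < k)%N, appears_at p x u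
                & appears_at p' x (u' + v)].

Definition is_phase (X : set (Z2 -> A)) (theta : nat) : Prop :=
  [/\ (0 < theta)%N, exists f, phased_block_gluing X f theta
    & forall k f, (0 < k)%N -> phased_block_gluing X f k -> (theta <= k)%N].

(* g is gamma_X; this determines g on the positive integers. *)
Definition is_gamma (X : set (Z2 -> A)) (g : nat -> nat) : Prop :=
  exists theta, [/\ is_phase X theta, phased_block_gluing X g theta
    & forall f, phased_block_gluing X f theta ->
        forall n, (0 < n)%N -> (g n <= f n)%N].

End Gluing.

Section Asymptotics.
Variable R : realType.

Definition bigO (g f : nat -> R) : Prop :=
  exists c K : R, [/\ 0 < c, 0 < K
    & forall n : nat, (0 < n)%N -> g n <= c * f n + K].

Definition bigTheta (g f : nat -> R) : Prop := bigO g f /\ bigO f g.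

End Asymptotics.

(* Main.v *)
(** Rows of a configuration are walks of the graph, and consecutive rows are pointwise adjacent walks. Fill the 4-cycles of the graph with cells and compare walks up to the resulting homotopy.

    If for every L some walk of length L + 2 is not homotopic to a walk of length L, then such geodesic walks are far from a checkerboard: D rows of a configuration form a homotopy from the first row to the left side followed by the last row and the right side, and the last row cancels, so that 2D is at least about the length.

    Otherwise every sufficiently long walk can be shortened, provided that a bounded amount of slack (an oscillation between two neighbors) is available next to it. Shifting part of a row opens a gap anywhere, so one unit of slack can be created in the middle of the remaining walk; both halves are then treated in parallel, and the number of rows needed grows by a constant when the length doubles.

    The spindle is a 5-cycle c with vertices e_i adjacent to c_i and c_(i+1), coned off by a vertex o. It is contractible, but there is a form, closed near c, which is maximal exactly on the edges of c; the defect of a row winding around c can therefore be multiplied by at most 9 from one row to the next. *)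

Require Import Defs.
From mathcomp Require Import all_boot all_order all_algebra.
From mathcomp Require Import boolp classical_sets reals exp.
From mathcomp Require Import zify lra.

Set Implicit Arguments.
Unset Strict Implicit.
Unset Printing Implicit Defensive.
Import Order.TTheory GRing.Theory Num.Theory.

(** * Walks and moves *)

Fixpoint iter_rel T (R : T -> T -> Prop) n x y : Prop :=
  if n is m.+1 then exists2 z, R x z & iter_rel R m z y else x = y.

Section IterRel.
Variables (T : Type) (R : T -> T -> Prop).

Lemma iter_rel_cat m n x y z :
  iter_rel R m x y -> iter_rel R n y z -> iter_rel R (m + n) x z.
Proof.
elim: m x => [|m IH] x /=; first by move=> ->.
by case=> t xt ty yz; exists t => //; apply: IH.
Qed.

Lemma iter_rel1 x y : R x y -> iter_rel R 1 x y.
Proof. by move=> xy; exists y. Qed.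

Lemma iter_rel_sym n x y : (forall a b, R a b -> R b a) ->
  iter_rel R n x y -> iter_rel R n y x.
Proof.
move=> symR; elim: n x => [|n IH] x /=; first by move=> ->.
case=> t xt ty; have := iter_rel_cat (IH _ ty) (iter_rel1 (symR _ _ xt)).
by rewrite addn1.
Qed.

Lemma iter_rel_fun n x y : iter_rel R n x y ->
  exists r : nat -> T, [/\ r 0 = x, r n = y & forall t, t < n -> R (r t) (r t.+1)].
Proof.
elim: n x => [|n IH] x /=; first by move=> ->; exists (fun=> y).
case=> t xt /IH[r [r0 rn rR]].
exists (fun i => if i is j.+1 then r j else x).
by split=> // -[|i] /=; [rewrite r0 | apply: rR].
Qed.

Lemma iter_rel_of_fun n (r : nat -> T) : (forall t, t < n -> R (r t) (r t.+1)) ->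
  iter_rel R n (r 0) (r n).
Proof.
elim: n r => [|n IH] r rR //; exists (r 1); first exact: rR.
by apply: (IH (fun t => r t.+1)) => t tn; apply: rR.
Qed.

End IterRel.

Lemma iter_rel_map T U (R : T -> T -> Prop) (R' : U -> U -> Prop) f n x y :
  (forall a b, R a b -> R' (f a) (f b)) -> iter_rel R n x y ->
  iter_rel R' n (f x) (f y).
Proof.
move=> RR'; elim: n x => [|n IH] x /=; first by move=> ->.
by case=> t /RR' xt /IH ty; exists (f t).
Qed.

Section Walks.
Variable G : fin_graph.
Implicit Types (w z u v : nat -> G) (s r : seq G) (a b c d : G).

Definition is_walk w := forall i, edge (w i) (w i.+1).

Definition adjacent_walks w w' :=
  [/\ is_walk w, is_walk w' & forall i, edge (w i) (w' i)].

Lemma adjacent_walks_sym w w' : adjacent_walks w w' -> adjacent_walks w' w.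
Proof. by case=> ww ww' e; split=> // i; rewrite edge_sym. Qed.

(* A move is realised by two rows of the grid, the intermediate one being [w] shifted to the right. *)
Definition move e w w' :=
  [/\ is_walk w, is_walk w', w' 0 = w 0, forall i, e <= i -> w' i = w i
    & forall i, edge (w i) (w' i.+1)].

Definition moves e n w w' := iter_rel (move e) n w w'.

Lemma move_refl e w : is_walk w -> move e w w.
Proof. by []. Qed.

Lemma move_le e e' w w' : e <= e' -> move e w w' -> move e' w w'.
Proof. by move=> le [? ? ? fx ?]; split=> // i /(leq_trans le)/fx. Qed.

Lemma moves_le e e' n w w' : e <= e' -> moves e n w w' -> moves e' n w w'.
Proof. by move=> le; apply: (iter_rel_map (f := id)) => a b; apply: move_le. Qed.

Lemma moves_refl e n w : is_walk w -> moves e n w w.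
Proof. by move=> ww; elim: n => //= n IH; exists w => //; apply: move_refl. Qed.

Lemma moves_walk e n w w' : is_walk w -> moves e n w w' -> is_walk w'.
Proof.
elim: n w => [|n IH] w ww /=; first by move=> <-.
by case=> t [_ wt _ _ _]; apply: IH.
Qed.

Lemma moves_fix e n w w' : moves e n w w' ->
  w' 0 = w 0 /\ forall i, e <= i -> w' i = w i.
Proof.
elim: n w => [|n IH] w /=; first by move=> ->.
case=> t [_ _ t0 tf _] /IH[w0 wf]; split; first by rewrite w0.
by move=> i ei; rewrite wf ?tf.
Qed.

Lemma moves_leq e n n' w w' : is_walk w -> n <= n' -> moves e n w w' -> moves e n' w w'.
Proof.
move=> ww le h; rewrite -(subnKC le); apply: (iter_rel_cat h).
by apply: moves_refl; apply: (moves_walk ww h).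
Qed.

Lemma moves_rows e n w w' : is_walk w -> moves e n w w' ->
  iter_rel adjacent_walks n.*2 w w'.
Proof.
elim: n w => [|n IH] w ww //=; case=> t [_ wt t0 _ wte] /(IH _ wt) tw'.
(* Position 0 of the shifted row needs a common neighbor of [w 0] and [t 0]; these are equal, so
   [w 1] serves. *)
pose r i := if i is j.+1 then w j else w 1.
have rw : is_walk r by case=> [|i] /=; rewrite ?ww // edge_sym ww.
exists r; first by split=> // -[|i] /=; rewrite ?ww // edge_sym ww.
exists t => //; split=> // -[|i] /=; last exact: wte.
by rewrite t0 edge_sym ww.
Qed.

Definition cat_walk m u v i : G := if i <= m then u i else v (i - m).

Lemma cat_walk_walk m u v : is_walk u -> is_walk v -> u m = v 0 ->
  is_walk (cat_walk m u v).
Proof.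
move=> wu wv uv i; rewrite /cat_walk.
case: (ltngtP i m) => im; first by rewrite wu.
  by rewrite subSn ?wv // ltnW.
by rewrite im subSnn uv.
Qed.

Lemma cat_walk_id m w : cat_walk m w (fun i => w (m + i)) = w.
Proof. apply/funext => i; rewrite /cat_walk; case: leqP => // im.
by rewrite subnKC // ltnW.
Qed.

Lemma cat_walkr m u v i : u m = v 0 -> cat_walk m u v (m + i) = v i.
Proof.
rewrite /cat_walk addKn => uv; case: leqP => //; case: i => [|i]; last by lia.
by rewrite addn0.
Qed.

Lemma move_cat m e u u' v v' : u m = v 0 -> move m u u' -> move e v v' ->
  move (m + e) (cat_walk m u v) (cat_walk m u' v').
Proof.
move=> uv [wu wu' u0 uf um] [wv wv' v0 vf vm].
have uv' : u' m = v' 0 by rewrite uf // v0.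
split; try exact: cat_walk_walk.
- by rewrite /cat_walk /= u0.
- move=> i ei; have -> : i = m + (i - m) by lia.
  by rewrite !cat_walkr // vf //; lia.
move=> i; rewrite /cat_walk.
case: (ltngtP i m) => im; first by rewrite um.
  by rewrite subSn ?vm // ltnW.
by rewrite im subSnn uv.
Qed.

(** Moves keep position 0 and everything from their bound on, so the junction at [m] stays put and
    both sides move at the same time. The logarithmic cost of halving rests on this. *)
Lemma moves_cat n m e u u' v v' : u m = v 0 -> moves m n u u' -> moves e n v v' ->
  moves (m + e) n (cat_walk m u v) (cat_walk m u' v').
Proof.
elim: n u v => [|n IH] u v uv /=; first by move=> -> ->.
case=> u1 uu1 u1u' [v1 vv1 v1v'].
exists (cat_walk m u1 v1); first exact: move_cat.
apply: IH => //; case: uu1 => _ _ _ -> //; case: vv1 => _ _ -> //.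
Qed.

Lemma moves_tail n m e w v' : is_walk w -> moves e n (fun i => w (m + i)) v' ->
  moves (m + e) n w (cat_walk m w v').
Proof.
move=> ww h; rewrite -{1}(cat_walk_id m w); apply: moves_cat => //; first by rewrite addn0.
exact: moves_refl.
Qed.

(** An alternation between two neighbors on [[p, q]], vacuous when [q < p + 2]. Such stretches are
    the slack that moves spend. *)
Definition osc p q z := forall i, p <= i -> i.+2 <= q -> z i.+2 = z i.

Lemma osc_sub p q p' q' z : p <= p' -> q' <= q -> osc p q z -> osc p' q' z.
Proof. by move=> lp lq h i pi iq; apply: h; lia. Qed.

Lemma osc_even p q z i k : osc p q z -> p <= i -> i + k.*2 <= q -> z (i + k.*2) = z i.
Proof.
move=> oz pi; elim: k => [|k IH] h; first by rewrite addn0.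
have -> : i + k.+1.*2 = (i + k.*2).+2 by lia.
by rewrite oz ?IH //; lia.
Qed.

(** The pair [z i], [z' i.+1] is an edge of [z] if [i = k], and of [z'] otherwise. *)
Lemma move_site e z z' k : is_walk z -> is_walk z' -> 0 < k -> k < e ->
  (forall i, i != k -> z' i = z i) -> move e z z'.
Proof.
move=> wz wz' k0 ke zz'; split=> //; first by rewrite zz' //; lia.
  by move=> i ei; rewrite zz' //; lia.
move=> i; have [ik|nik] := eqVneq i k; last by rewrite -zz'.
by rewrite zz' ?wz //; lia.
Qed.

(** Inside the stretch, the partner of [z q] is replaced by [z q.+1]: the oscillation gains a
    position on the right and loses one on the left. *)
Lemma transport p q z : is_walk z -> osc p q z ->
  exists2 z', move q z z' & osc p.+1 q.+1 z'.
Proof.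
move=> wz oz.
pose z' i := if [&& p < i, i < q & odd (q - i)] then z q.+1 else z i.
have zq i : p <= i -> i <= q -> ~~ odd (q - i) -> z i = z q.
  move=> pi iq ev; have -> : q = i + (q - i)./2.*2 by lia.
  by rewrite (osc_even oz) //; lia.
have wz' : is_walk z'.
  move=> i; rewrite /z'; case: ifP => c1; case: ifP => c2 //; try by lia.
  - have -> : z i.+1 = z q by apply: zq; lia.
    by rewrite edge_sym.
  - have -> : z i = z q by apply: zq; lia.
    by [].
exists z'.
  split=> //.
  - by move=> i qi; rewrite /z'; case: ifP => //; lia.
  - move=> i; rewrite /z'; case: ifP => c1 //.
    have -> : z i = z q by apply: zq; lia.
    by [].
move=> i pi iq; rewrite /z'; case: ifP => c1; case: ifP => c2 //.
- lia.
- have -> : i.+1 = q by lia.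
  by [].
- by apply: oz; lia.
Qed.

Lemma transports n p q z : is_walk z -> osc p q z ->
  exists2 z', moves (q + n.-1) n z z' & osc (p + n) (q + n) z'.
Proof.
elim: n p q z => [|n IH] p q z wz oz; first by exists z => //; rewrite !addn0.
have [z1 mz1 oz1] := transport wz oz.
have wz1 : is_walk z1 by case: mz1.
have [z2 mz2 oz2] := IH _ _ _ wz1 oz1.
exists z2; last by rewrite !addnS.
exists z1; first by apply: move_le mz1; lia.
by case: n {IH oz2} mz2 => //= n; rewrite addSnnS.
Qed.

(* Shifting [h+2, q] by two to the right opens a gap at [h], paid for by the oscillation after [q]. *)
Lemma open_gap (h c q e : nat) z : is_walk z -> osc h (h + c) z -> osc q e z ->
  h + c <= q -> q.+2 <= e ->
  exists z', [/\ move e z z', osc h (h + c.+2) z' & osc q.+2 e z'].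
Proof.
move=> wz o1 o2 hq qe.
pose z' i := if (i < h.+2) || (q.+2 <= i) then z i else z i.-2.
have wz' : is_walk z'.
  move=> i; rewrite /z'; case: ifP => c1; case: ifP => c2 //.
  - have -> : i = h.+1 by lia.
    by rewrite edge_sym.
  - have -> : i = q.+1 by lia.
    by rewrite /= o2 // -{2}(prednK (_ : 0 < q)) ?wz //; lia.
  - by have := wz i.-2; have -> : i.-2.+1 = i.+1.-2 by lia.
exists z'; split.
- split=> //.
    by move=> i ei; rewrite /z' (_ : q.+2 <= i) ?orbT //; lia.
  move=> i; rewrite /z'; case: ifP => c1 //.
  by have := wz i.-1; rewrite edge_sym prednK //; lia.
- move=> i hi ic; rewrite /z'; case: ifP => c1; case: ifP => c2 //=; try by lia.
  + by apply: o2; lia.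
  + have -> : i = q by lia.
    rewrite o2 //; have := o1 q.-2; rewrite !prednK; try lia.
    by apply; lia.
  + by have := o1 i.-2; rewrite !prednK; try lia; apply; lia.
- move=> i hi ic; rewrite /z'; case: ifP => c1; case: ifP => c2 //=; try by lia.
  by apply: o2; lia.
Qed.

Lemma open_gaps n (h c q e : nat) z : is_walk z -> osc h (h + c) z -> osc q e z ->
  h + c <= q -> q + n.*2 <= e ->
  exists z', [/\ moves e n z z', osc h (h + (c + n.*2)) z' & osc (q + n.*2) e z'].
Proof.
elim: n c q z => [|n IH] c q z wz o1 o2 hq qe; first by exists z; rewrite !addn0.
have [|z1 [m1 o11 o12]] := open_gap wz o1 o2 hq; first by lia.
have wz1 : is_walk z1 by case: m1.
have [||z2 [m2 o21 o22]] := IH _ _ _ wz1 o11 o12; try lia.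
exists z2; split; first by exists z1.
  by have -> : c + n.+1.*2 = c.+2 + n.*2 by lia.
by have -> : q + n.+1.*2 = q.+2 + n.*2 by lia.
Qed.

End Walks.

(** * Square homotopy *)

Section Homotopy.
Variable G : fin_graph.
Implicit Types (w z u v : nat -> G) (s r : seq G) (a b c d : G).

(** Only the values up to [M] are kept; bouncing between the last two of them supplies unlimited
    slack. *)
Definition osc_walk M w i : G := if i <= M then w i else w (M - odd (i - M)).

Lemma osc_walk_walk M w : 0 < M -> (forall i, i < M -> edge (w i) (w i.+1)) ->
  is_walk (osc_walk M w).
Proof.
move=> M0 ww i; rewrite /osc_walk; case: ltngtP => iM; first exact: ww.
  rewrite subSn ?oddS; last by lia.
  have := ww M.-1; rewrite prednK // => /(_ (leqnn _)).
  by case: odd => /= h; rewrite ?subn0 ?subn1 // edge_sym.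
rewrite iM subSnn /= subn1 edge_sym.
by have := ww M.-1; rewrite prednK //; apply; lia.
Qed.

Lemma osc_walk_osc M w q : 0 < M -> osc M.-1 q (osc_walk M w).
Proof.
move=> M0 i Mi _; rewrite /osc_walk.
have [iM|iM] := leqP i.+2 M; first by lia.
have [iM'|iM'] := leqP i M; last by rewrite !subSn ?oddS ?negbK //; lia.
have [->|->] : i = M \/ i = M.-1 by lia.
  by rewrite -addn2 addKn subn0.
by rewrite (_ : M.-1.+2 - M = 1) ?subn1 //; lia.
Qed.

Lemma osc_walk_id M w : osc_walk M (osc_walk M w) = osc_walk M w.
Proof.
by apply/funext => i; rewrite /osc_walk; case: (leqP i M) => // _; rewrite leq_subr.
Qed.

Inductive homotopic : seq G -> seq G -> Prop :=
| Homotopic_refl s : homotopic s s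
| Homotopic_sym s r : homotopic s r -> homotopic r s
| Homotopic_trans s r t : homotopic s r -> homotopic r t -> homotopic s t
| Homotopic_back s1 a b s2 : edge a b ->
    homotopic (s1 ++ a :: s2) (s1 ++ [:: a, b, a & s2])
| Homotopic_square s1 a b c d s2 : edge a b -> edge b c -> edge a d -> edge d c ->
    homotopic (s1 ++ [:: a, b, c & s2]) (s1 ++ [:: a, d, c & s2]).

Lemma homotopic_ctx x y s r : homotopic s r -> homotopic (x ++ s ++ y) (x ++ r ++ y).
Proof.
elim=> [*|*|*|s1 a b s2 ab|s1 a b c d s2 ab bc ad dc].
- exact: Homotopic_refl.
- exact: Homotopic_sym.
- by apply: Homotopic_trans; eassumption.
- by rewrite -!catA !catA -!(catA (x ++ s1)) !cat_cons; apply: Homotopic_back.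
- by rewrite -!catA !catA -!(catA (x ++ s1)) !cat_cons; apply: Homotopic_square.
Qed.

Lemma homotopic_odd_size s r : homotopic s r -> odd (size s) = odd (size r).
Proof. by elim=> [||? ? ? _ -> _ ->||] // *; rewrite !size_cat /=; lia. Qed.

Lemma homotopic_nil s r : homotopic s r -> (s == [::]) = (r == [::]).
Proof. by elim=> [||? ? ? _ -> _ ->||] //; case. Qed.

Definition word_osc s e z := s = mkseq z (size s) /\ osc (size s).-1 e z.

Lemma word_oscP s x0 e z : (forall i, i < size s -> z i = nth x0 s i) ->
  osc (size s).-1 e z -> word_osc s e z.
Proof.
move=> h o; split=> //; apply: (@eq_from_nth _ x0) => [|i si]; first by rewrite size_mkseq.
by rewrite nth_mkseq ?h.
Qed.

Lemma word_osc_nth s x0 e z i : word_osc s e z -> i < size s -> z i = nth x0 s i.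
Proof. by case=> E _ si; rewrite [in RHS]E nth_mkseq. Qed.

(** A single [N], uniform in [e] and [z], says both how far the slack must reach and how many moves
    are made. *)
Definition realizes s r := exists N, forall e z, N <= e -> is_walk z ->
  word_osc s e z -> exists2 z', moves e N z z' & word_osc r e z'.

Lemma realizes_trans s r t : realizes s r -> realizes r t -> realizes s t.
Proof.
move=> [N1 h1] [N2 h2]; exists (N1 + N2) => e z le wz sz.
have [z1 m1 r1] := h1 e z (leq_trans (leq_addr _ _) le) wz sz.
have [z2 m2 r2] := h2 e z1 (leq_trans (leq_addl _ _) le) (moves_walk wz m1) r1.
by exists z2 => //; apply: iter_rel_cat m1 m2.
Qed.

(** One move suffices: the letters after the backtrack shift right by two, and the final oscillation
    absorbs them. *)
Lemma realizes_back s1 a b s2 : edge a b ->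
  realizes (s1 ++ a :: s2) (s1 ++ [:: a, b, a & s2]).
Proof.
move=> ab; set s := s1 ++ a :: s2; set r := s1 ++ _.
pose h := size s1; pose q := (size s).-1.
have sq : size s = q.+1 by rewrite /q /s size_cat /= addnS.
have rq : size r = q.+3 by rewrite -sq /r /s !size_cat /=; lia.
have hq : h <= q by rewrite /q /s size_cat /=; lia.
exists q.+2 => e z qe wz sz.
have zs i : i <= q -> z i = nth a s i by move=> iq; apply: (word_osc_nth _ sz); lia.
have zh : z h = a by rewrite zs // nth_cat ltnn subnn.
case: sz => _; rewrite -/q => oz.
pose z' i := if i <= h then z i else if i == h.+1 then b
  else if i < q.+2 then z i.-2 else z i.
have wz' : is_walk z'.
  move=> i; rewrite /z'; case: (ltngtP i h) => ih; first by have := wz i.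
    have [->|i1] := eqVneq i h.+1.
      rewrite (_ : (_ == h.+1) = false) /=; last by lia.
      case: ifP => hq2; first by rewrite zh edge_sym.
      have -> : h.+2 = q.+2 by lia.
      have hq' : h = q by lia.
      by rewrite oz // -hq' zh edge_sym.
    rewrite eqSS (negbTE (_ : i != h)) //; last by lia.
    case: ifP => c1; case: ifP => c2; try by lia.
    - by have := wz i.-2; have -> : i.-2.+1 = i.+1.-2 by lia.
    - have -> : i = q.+1 by lia.
      rewrite oz //=; have := wz q.-1; rewrite prednK //; lia.
    - by have := wz i.
  by rewrite ih eqxx zh.
exists z'.
  apply: (@moves_leq _ _ 1) => //; apply: iter_rel1; split=> //.
    by move=> i ei; rewrite /z'; repeat case: ifP => ?; rewrite //; lia.
  move=> i; rewrite /z'; case: ifP => c1; first exact: wz.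
  case: ifP => [/eqP[->]|c2]; first by rewrite zh.
  case: ifP => c3; last exact: wz.
  by have := wz i.-1; rewrite edge_sym prednK //; lia.
apply: (@word_oscP _ a).
  move=> i; rewrite rq => ir; rewrite /z' /r nth_cat -/h.
  case: (ltngtP i h) => ih.
  - by rewrite zs; [rewrite nth_cat ih | lia].
  - case: ifP => [/eqP ->|c1]; first by rewrite subSnn.
    have -> : (if i < q.+2 then z i.-2 else z i) = z i.-2.
      case: ltnP => // iq; have -> : i = q.+2 by lia.
      exact: oz.
    have -> : i - h = (i - h.+2).+2 by lia.
    rewrite /= zs; last by lia.
    rewrite nth_cat -/h (_ : i.-2 < h = false); last by lia.
    by have -> : i.-2 - h = i - h.+2 by lia.
  - by rewrite ih subnn zh.
rewrite rq /= => i qi ie; rewrite /z'.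
do 6?[case: ifP => ?]; try by lia.
by apply: oz => //; lia.
Qed.

(** Shifting left by two is not a single move in general, so the backtrack travels right, one site
    per move: in [d k] the [k] positions after [h] have their final letters. *)
Lemma realizes_unback s1 a b s2 : edge a b ->
  realizes (s1 ++ [:: a, b, a & s2]) (s1 ++ a :: s2).
Proof.
move=> ab; set s := s1 ++ [:: _, _, _ & _]; set r := s1 ++ _.
pose h := size s1; pose q := (size s).-1.
have sq : size s = q.+1 by rewrite /q /s size_cat /= addnS.
have rq : size r = q.-1 by rewrite /q /r /s !size_cat /=; lia.
have hq : h.+2 <= q by rewrite /q /s size_cat /=; lia.
exists q.+2 => e z qe wz sz.
have zs i : i <= q -> z i = nth a s i by move=> iq; apply: (word_osc_nth _ sz); lia.
have zh : z h = a by rewrite zs ?nth_cat ?ltnn ?subnn //; lia.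
have zh2 : z h.+2 = a by rewrite zs // nth_cat -/h ltnNge ltnW //= -addn2 addKn.
case: sz => _; rewrite -/q => oz.
pose d k i := if (h < i) && (i <= h + k) then z i.+2 else z i.
have wd k : is_walk (d k).
  move=> i; rewrite /d; case: ifP => c1; case: ifP => c2 //.
  - have : edge (z i.+2) (z i.+1) by rewrite edge_sym.
    by [].
  - have -> : i = h by lia.
    by rewrite zh -zh2.
have md k : k < q - h -> move e (d k) (d k.+1).
  move=> kq; apply: (@move_site _ _ _ _ (h + k).+1) => //; try by lia.
  by move=> i ik; rewrite /d; case: ifP => c1; case: ifP => c2 //; lia.
have msd k : k <= q - h -> moves e k z (d k).
  elim: k => [_|k IH kq].
    by apply/funext => i; rewrite /d; case: ifP => //; lia.
  rewrite /moves -[X in iter_rel _ X]addn1; apply: iter_rel_cat (IH _) _; first by lia.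
  by apply: iter_rel1; apply: md; lia.
(* Positions up to [q.-1] are shifted: [q.-2] receives the last letter and [q.-1] its partner, so
   the oscillation starts at [q.-2]. *)
exists (d (q.-1 - h)).
  by apply: (moves_leq wz _ (msd _ _)); lia.
have dE i : i <= q.-2 -> d (q.-1 - h) i = nth a r i.
  move=> iq; rewrite /d /r nth_cat -/h.
  case: (ltngtP i h) => ih /=.
  - by rewrite zs; [rewrite nth_cat ih | lia].
  - rewrite (_ : i <= _ = true); last by lia.
    rewrite zs; last by lia.
    rewrite nth_cat -/h (_ : i.+2 < h = false); last by lia.
    have -> : i.+2 - h = (i - h.+1).+3 by lia.
    by have -> : i - h = (i - h.+1).+1 by lia.
  - by rewrite ih subnn zh.
apply: (@word_oscP _ a); first by move=> i; rewrite rq => ir; apply: dE; lia.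
rewrite rq => i qi ie; rewrite /d.
case: ifP => c1; case: ifP => c2; try by lia.
- by [].
- have [ih|ih] := eqVneq i h; first by rewrite ih zh2 zh.
  by apply: oz; lia.
Qed.

Lemma realizes_square s1 a b c d s2 : edge a b -> edge b c -> edge a d -> edge d c ->
  realizes (s1 ++ [:: a, b, c & s2]) (s1 ++ [:: a, d, c & s2]).
Proof.
move=> ab bc ad dc; set s := s1 ++ _; set r := s1 ++ _.
pose h := size s1; pose q := (size s).-1.
have sq : size s = q.+1 by rewrite /q /s size_cat /= addnS.
have rq : size r = q.+1 by rewrite -sq /r /s !size_cat /=; lia.
have hq : h.+2 <= q by rewrite /q /s size_cat /=; lia.
exists q.+2 => e z qe wz sz.
have zs i : i <= q -> z i = nth a s i by move=> iq; apply: (word_osc_nth _ sz); lia.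
have zh : z h = a by rewrite zs ?nth_cat ?ltnn ?subnn //; lia.
have zh2 : z h.+2 = c by rewrite zs // nth_cat -/h ltnNge ltnW //= -addn2 addKn.
case: sz => _; rewrite -/q => oz.
pose z' i := if i == h.+1 then d else z i.
have wz' : is_walk z'.
  move=> i; rewrite /z'; case: eqP => [->|c1]; first by rewrite eqn_leq ltnn zh2.
  by case: eqP => [[->]|//]; rewrite zh.
exists z'.
  apply: (@moves_leq _ _ 1) => //; apply: iter_rel1.
  apply: (@move_site _ _ _ _ h.+1) => //; try by lia.
  by move=> i /negbTE ih; rewrite /z' ih.
apply: (@word_oscP _ a); rewrite rq.
  move=> i iq; rewrite /z' /r nth_cat -/h.
  case: (ltngtP i h) => ih.
  - by rewrite (_ : i == _ = false) ?zs ?nth_cat -/h ?ih //; lia.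
  - have [->|ni] := eqVneq i h.+1; first by rewrite subSnn.
    rewrite zs // nth_cat -/h (_ : i < h = false); last by lia.
    by have -> : i - h = (i - h.+2).+2 by lia.
  - by rewrite ih subnn (_ : h == _ = false) ?zh //; lia.
move=> i /= qi ie; rewrite /z'; case: ifP => c1; first by lia.
by case: ifP => c2; [lia | apply: oz].
Qed.

(** Both directions are proved together to pass through [Homotopic_sym]; inserting and removing a
    backtrack are different constructions. *)
Lemma homotopic_realizes s r : homotopic s r -> realizes s r /\ realizes r s.
Proof.
elim=> [{}s|{}s {}r _ []|{}s {}r t _ [sr rs] _ [rt tr]|s1 a b s2 ab|s1 a b c d s2 ab bc ad dc].
- have rf : realizes s s by exists 0 => e z _ wz sz; exists z.
  by split.
- by move=> sr rs; split.
- by split; apply: realizes_trans; eassumption.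
- by split; [exact: realizes_back | exact: realizes_unback].
- by split; apply: realizes_square.
Qed.

End Homotopy.

(** * Collapsing a walk to an oscillation *)

Lemma uniform_bound (T : finType) (Q : T -> nat -> Prop) :
  (forall t m n, m <= n -> Q t m -> Q t n) -> (forall t, exists n, Q t n) ->
  exists n, forall t, Q t n.
Proof.
move=> Qle /choice[f fQ]; exists (\max_t f t) => t.
by apply: Qle (fQ t); apply: leq_bigmax.
Qed.

Section Collapse.
Variable G : fin_graph.
Implicit Types w z u v : nat -> G.

(* Equivalently, the walks of length [L + 2] are not geodesic in the square cover of [G]. *)
Definition contractible L := forall w, is_walk w ->
  exists2 r, size r = L.+1 & homotopic (mkseq w L.+3) r.

(** There are finitely many words of [L + 3] letters, so the bounds given by [homotopic_realizes]
    have a maximum. *)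
Lemma contract L : contractible L ->
  exists N, forall e z, N <= e -> is_walk z -> osc L.+2 e z ->
    exists2 z', moves e N z z' & osc L e z'.
Proof.
move=> cL.
pose Q (t : (L.+3).-tuple G) N := forall e z, N <= e -> is_walk z ->
  mkseq z L.+3 = t -> osc L.+2 e z -> exists2 z', moves e N z z' & osc L e z'.
have [|t|N NQ] := @uniform_bound _ Q.
- move=> t m n mn Qm e z ne wz zt oz.
  have [z' zz' oz'] := Qm e z (leq_trans mn ne) wz zt oz.
  by exists z' => //; apply: moves_leq zz'.
- have [[w ww wt]|nt] := pselect (exists2 w, is_walk w & mkseq w L.+3 = t); last first.
    by exists 0 => e z _ wz zt _; case: nt; exists z.
  have [r sr wr] := cL _ ww.
  have [[N hN] _] := homotopic_realizes wr.
  exists N => e z Ne wz zt oz.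
  have [|z' zz' [_ oz']] := hN e z Ne wz.
    by rewrite wt; split; rewrite size_tuple.
  by exists z' => //; rewrite sr in oz'.
exists N => e z Ne wz oz.
by apply: (NQ [tuple of mkseq z L.+3]).
Qed.

(** * Logarithmic collapse by halving *)

Section Contracting.
Variables (L N : nat).
Hypothesis contractN : forall e z, N <= e -> is_walk z -> osc L.+2 e z ->
  exists2 z', moves e N z z' & osc L e z'.

Lemma contract_by j a e z : L <= a -> a + j.*2 + N <= e -> is_walk z ->
  osc (a + j.*2) e z -> exists2 z', moves e (N * j) z z' & osc a e z'.
Proof.
move=> La; elim: j z => [|j IH] z ae wz oz.
  by exists z; rewrite ?muln0 // addn0 in oz *.
(* The window of length [L + 2] that ends where the oscillation currently starts. *)
pose m := a + j.*2 - L.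
have wt : is_walk (fun i => z (m + i)) by move=> i; rewrite addnS.
have [||v' mv' ov'] := @contractN (e - m) _ _ wt; first by lia.
  by move=> i Li ie; rewrite !addnS; apply: oz; lia.
have mz := moves_tail wz mv'.
have me : m + (e - m) = e by lia.
rewrite me in mz.
have [_ _] := moves_fix mv'.
have v0 : z m = v' 0 by case: (moves_fix mv') => ->; rewrite addn0.
have [||z' zz' oz'] := IH _ _ (moves_walk wz mz); first by lia.
  move=> i ai ie; have -> : i = m + (i - m) by lia.
  by rewrite -!addnS !cat_walkr //; apply: ov'; lia.
exists z' => //; rewrite mulnS; exact: iter_rel_cat mz zz'.
Qed.

(** The start of the oscillation moves by two each time, so parity decides between [L] and [L + 1].
    The cost is linear in [m]; it will be used for bounded [m] only. *)
Lemma contract_to m e z : m + N <= e -> is_walk z -> osc m e z ->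
  exists2 z', moves e (N * m) z z' & osc L.+1 e z'.
Proof.
move=> me wz oz; have [mL|Lm] := leqP m L.+1.
  by exists z; [exact: moves_refl | apply: osc_sub oz].
pose j := (m - L)./2; pose a := m - j.*2.
have maj : m = a + j.*2 by lia.
rewrite maj in oz.
have [||z' zz' oz'] := @contract_by j a e z _ _ wz oz; try by lia.
exists z'; last by apply: osc_sub oz'; lia.
by apply: moves_leq zz' => //; rewrite leq_mul2l; lia.
Qed.

(** [A] is the start that contraction reaches, [2 * s] the slack kept available, [M0] the length
    below which contraction is direct. The summands of [cost] pay for contracting, opening the gap,
    transporting, contracting again, and the base case. *)
Let A := L.+1.
Let s := (N + L).+1.
Let M0 := (A + s).*2.*2.
Let cost := N * s + s + A.+1 + N * A.*2.+1 + N * M0.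

(** For [m > M0], a gap opened in the middle leaves two problems of at most half the length, solved
    simultaneously; everything else takes a bounded number of moves, so a doubling adds one
    [cost]. *)
Lemma collapse_osc k m z : m <= M0 * 2 ^ k -> is_walk z -> osc m (m + s.*2) z ->
  exists2 z', moves (m + s.*2) (cost * k.+1) z z' & osc A (m + s.*2) z'.
Proof.
have base n m' z' : 0 < n -> m' <= M0 -> is_walk z' -> osc m' (m' + s.*2) z' ->
    exists2 z'', moves (m' + s.*2) (cost * n) z' z'' & osc A (m' + s.*2) z''.
  move=> n0 mM wz oz; have [|z1 m1 o1] := contract_to _ wz oz; first by rewrite /s; lia.
  exists z1 => //; apply: moves_leq m1 => //.
  apply: leq_trans (leq_pmulr _ n0); rewrite /cost.
  by apply: leq_trans (leq_addl _ _); rewrite leq_mul2l mM orbT.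
elim: k m z => [|k IH] m z mk wz oz; first by apply: base => //; rewrite muln1 in mk.
have [mM|Mm] := leqP m M0; first exact: base.
(* The oscillation now starts [2 * s] earlier: this pays for the gap and leaves [2 * s] of slack at
   the right end. *)
have [|||z1 m1 o1] := @contract_by s (m - s.*2) (m + s.*2) z _ _ wz; try by rewrite /M0 /s in Mm *; lia.
  by have -> : m - s.*2 + s.*2 = m by rewrite /M0 in Mm *; lia.
have wz1 := moves_walk wz m1.
pose h := m./2.
have [|||z2 [m2 o2 o2']] := @open_gaps _ s h 0 (m - s.*2) (m + s.*2) z1 wz1 _ o1; try by rewrite /M0 in Mm *; lia.
  by move=> i hi ih; lia.
have wz2 := moves_walk wz1 m2.
have mE : m - s.*2 + s.*2 = m by rewrite /M0 in Mm *; lia.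
rewrite mE add0n in o2 o2'.
have mk' : m <= (M0 * 2 ^ k).*2 by rewrite expnS in mk; lia.
(* The left half spends the gap as its slack, the right half the slack at the end. *)
have [|u' mu' ou'] := IH h z2 _ wz2 o2; first by lia.
pose m' := m - h - s.*2.
have m'E : h + s.*2 + m' = m by rewrite /M0 in Mm *; lia.
have wt : is_walk (fun i => z2 (h + s.*2 + i)) by move=> i; rewrite addnS.
have [||v' mv' ov'] := IH m' _ _ wt; first by rewrite /s; lia.
  by move=> i mi im; rewrite 2!addnS; apply: o2'; lia.
have uv : z2 (h + s.*2) = (fun i => z2 (h + s.*2 + i)) 0 by rewrite addn0.
have m3 := moves_cat uv mu' mv'.
rewrite cat_walk_id in m3.
have m'E' : h + s.*2 + (m' + s.*2) = m + s.*2 by lia.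
rewrite m'E' in m3.
have uv' : u' (h + s.*2) = v' 0.
  case: (moves_fix mu') => _ ->//; case: (moves_fix mv') => ->.
  by rewrite addn0.
set z3 := cat_walk _ u' v' in m3.
have wz3 := moves_walk wz2 m3.
have o3 : osc A (h + s.*2) z3.
  move=> i Ai ih; rewrite /z3 /cat_walk ih (leq_trans _ ih) ?ou' //.
  by lia.
have o3' : osc (h + s.*2 + A) (m + s.*2) z3.
  move=> i Ai ih; have -> : i = h + s.*2 + (i - (h + s.*2)) by lia.
  by rewrite -!addnS /z3 !cat_walkr // ov' //; lia.
(* The right oscillation starts [A] after the left one ends. Carried right by [A + 1], the left one
   shares an edge with it, and the two merge. *)
have [z4 m4 o4] := transports A.+1 wz3 o3.
have [_ z4E] := moves_fix m4.
have wz4 := moves_walk wz3 m4.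
have hm : (h + s.*2) + A.+2 <= m + s.*2 by rewrite /M0 in Mm *; lia.
have o4' : osc A.*2.+1 (m + s.*2) z4.
  move=> i Ai im; have [ih|hi] := leqP i.+2 (h + s.*2 + A.+1); first by apply: o4; lia.
  by rewrite !z4E //=; try lia; apply: o3'; lia.
have [|z5 m5 o5] := contract_to _ wz4 o4'; first by rewrite /M0 /s in Mm *; lia.
exists z5 => //.
have m4' : moves (m + s.*2) A.+1 z3 z4 by apply: moves_le m4; rewrite /=; lia.
have := iter_rel_cat (iter_rel_cat (iter_rel_cat (iter_rel_cat m1 m2) m3) m4') m5.
apply: moves_leq => //; rewrite (mulnS _ k.+1) /cost; lia.
Qed.

End Contracting.

Definition collapses T M := forall w, is_walk w ->
  exists2 v, iter_rel (@adjacent_walks G) T (osc_walk M w) v & forall i, v i.+2 = v i.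

Lemma osc_walk_rows M n w v : 0 < M ->
  iter_rel (@adjacent_walks G) n w v ->
  iter_rel (@adjacent_walks G) n (osc_walk M w) (osc_walk M v).
Proof.
move=> M0; apply: iter_rel_map => a b [wa wb ab].
split; try by apply: osc_walk_walk.
by move=> i; rewrite /osc_walk; case: ifP.
Qed.

Lemma osc_walk_oscT M w : 0 < M -> osc 0 M w -> forall i, osc_walk M w i.+2 = osc_walk M w i.
Proof.
move=> M0 ow i; have [Mi|iM] := leqP M.-1 i.
  exact: (osc_walk_osc w M0 Mi (leqnn _)).
by rewrite /osc_walk !ifT ?ow //; lia.
Qed.

(** A walk is adjacent to its own shift by one, so an oscillation starting at [n] is brought to 0 in
    [n] rows. *)
Lemma shift_rows w n : is_walk w ->
  iter_rel (@adjacent_walks G) n w (fun i => w (n + i)).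
Proof.
move=> ww; apply: (iter_rel_of_fun (r := fun t i => w (t + i))) => t _.
by split=> i; rewrite ?addnS // addSn.
Qed.

Lemma collapses_linear M : 0 < M -> collapses M M.
Proof.
move=> M0 w ww; exists (fun i => osc_walk M w (M + i)).
  exact/shift_rows/osc_walk_walk.
by move=> i; rewrite 2!addnS; apply: (osc_walk_osc w M0 _ (leqnn _)); lia.
Qed.

Lemma collapses_log L : contractible L ->
  exists C A, forall k M, 0 < M -> M <= 2 ^ k -> collapses ((C * k.+1).*2 + A) M.
Proof.
case/contract => N hN.
pose s := (N + L).+1.
pose C := N * s + s + L.+2 + N * L.+1.*2.+1 + N * (L.+1 + s).*2.*2.
exists C, L.+1 => k M M0 Mk w ww.
have wo := osc_walk_walk M0 (fun i _ => ww i).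
have [||z mz oz] := @collapse_osc L N hN k M _ _ wo.
- by apply: leq_trans Mk _; apply: leq_pmull; lia.
- by move=> i Mi iM; apply: (@osc_walk_osc _ M w (M + s.*2)) => //; lia.
(* Since [L + 1 <= 2 * s], positions 0 to [M] of the shifted walk lie inside the oscillation of
   [z]. *)
exists (osc_walk M (fun i => z (L.+1 + i))).
  rewrite -(osc_walk_id M w); apply: osc_walk_rows => //.
  apply: iter_rel_cat (moves_rows wo mz) _.
  by apply: shift_rows; apply: moves_walk mz.
by apply: osc_walk_oscT => // i _ iM; rewrite 2!addnS; apply: oz; lia.
Qed.

End Collapse.

(** * Interpolation between two rows *)

Section Interpolation.
Variable G : fin_graph.
Implicit Types w v : nat -> G.

Definition walk_between (l : nat) (a b : G) :=
  exists g, [/\ is_walk g, g 0 = a & g l = b].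

(** For [theta = 1] every large length occurs; for [theta = 2] one of two consecutive lengths does,
    which accommodates bipartite graphs. *)
Definition spread (theta N : nat) := forall (a b : G) m, N <= m ->
  exists2 j, j < theta & walk_between (m + j) a b.

(** A single walk [h] runs through [w 0], [w 1], along [g], then [w' 0], [w' 1]; row [t] alternates
    between [h t] and [h t.+1]. *)
Lemma osc_rows w w' m : is_walk w -> is_walk w' -> (forall i, w i.+2 = w i) ->
  (forall i, w' i.+2 = w' i) -> walk_between m (w 1) (w' 0) ->
  iter_rel (@adjacent_walks G) m.+1 w w'.
Proof.
move=> ww ww' ow ow' [g [wg g0 gm]].
have oddE (z : nat -> G) i : (forall i, z i.+2 = z i) -> z i = z (odd i).
  move=> oz; elim/ltn_ind: i => -[|[|i]] // IH.
  by rewrite oz IH //= negbK.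
pose h i := if i is j.+1 then cat_walk m g w' j else w 0.
have wc : is_walk (cat_walk m g w') by apply: cat_walk_walk.
have wh : is_walk h by case=> [|i] //=; rewrite /cat_walk /= g0.
have -> : w = (fun i => h (0 + odd i)).
  by apply/funext => i; rewrite (oddE w) //; case: odd; rewrite //= /cat_walk /= g0.
have -> : w' = (fun i => h (m.+1 + odd i)).
  apply/funext => i; rewrite (oddE w') //; case: odd; rewrite ?addn1 ?addn0 /= /cat_walk.
    by rewrite ltnn subSnn.
  by rewrite leqnn.
apply: (iter_rel_of_fun (r := fun t i => h (t + odd i))) => t _.
split=> i /=; rewrite ?addSn //;
  by case: odd; rewrite /= ?addn0 ?addn1 // edge_sym.
Qed.

(** Both rows collapse, the second in reverse, and [osc_rows] bridges the two alternating rows; [j]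
    will become the vertical phase. *)
Lemma interpolation theta N T M w w' D : spread theta N -> collapses G T M -> 0 < M ->
  is_walk w -> is_walk w' -> T.*2 + N < D ->
  exists2 j, j < theta &
    iter_rel (@adjacent_walks G) (D + j) (osc_walk M w) (osc_walk M w').
Proof.
move=> sp cT M0 ww ww' DT.
have [v wv ov] := cT _ ww; have [v' wv' ov'] := cT _ ww'.
have rows_walk n a b : is_walk a -> iter_rel (@adjacent_walks G) n a b -> is_walk b.
  by elim: n a => [|n IH] a wa /=; [move=> <- | case=> t [_ wt _] /IH; apply].
have wo := osc_walk_walk M0 (fun i _ => ww i).
have wo' := osc_walk_walk M0 (fun i _ => ww' i).
have [|j jt vv'] := sp (v 1) (v' 0) (D - T.*2.+1); first by lia.
exists j => //.
have -> : D + j = T + (D - T.*2.+1 + j).+1 + T by lia.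
apply: iter_rel_cat (iter_rel_cat wv _) (iter_rel_sym (@adjacent_walks_sym G) wv').
by apply: osc_rows => //; [apply: rows_walk wv | apply: rows_walk wv'].
Qed.

(** * Folding the line onto an interval *)

Local Open Scope ring_scope.

(** The distance to the nearest multiple of [2 * M]; its mirrors are the multiples of [M]. *)
Definition triangle_wave (M : nat) (z : int) : nat :=
  absz (z - ((z + M%:Z) %/ M.*2%:Z)%Z * M.*2%:Z)%R.

Lemma triangle_waveE M (q k : int) : (0 < M)%N -> - M%:Z <= k <= M%:Z ->
  triangle_wave M (q * M.*2%:Z + k) = absz k.
Proof.
move=> M0 /andP[k1 k2]; rewrite /triangle_wave -(addrA _ k M%:Z) divzMDl; last by lia.
have [->|kM] := eqVneq k M%:Z.
  have -> : M%:Z + M%:Z = M.*2%:Z by lia.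
  by rewrite divzz (_ : _ != 0 :> int) //=; lia.
by rewrite divz_small; [congr absz; lia | apply/andP; split; lia].
Qed.

Lemma triangle_wave_mod M (z : int) : (0 < M)%N ->
  exists q k : int, [/\ z = q * M.*2%:Z + k, - M%:Z <= k & k < M%:Z].
Proof.
move=> M0; have d0 : M.*2%:Z != 0 :> int by lia.
exists ((z + M%:Z) %/ M.*2%:Z)%Z, (((z + M%:Z) %% M.*2%:Z)%Z - M%:Z).
have := divz_eq (z + M%:Z) M.*2%:Z.
have := modz_ge0 (z + M%:Z) d0; have := ltz_mod (z + M%:Z) d0.
move: (_ %% _)%Z (_ * _) => r qq; split; lia.
Qed.

Lemma triangle_wave_le M (z : int) : (0 < M)%N -> (triangle_wave M z <= M)%N.
Proof.
move=> M0; have [q [k [-> k1 k2]]] := triangle_wave_mod z M0.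
by rewrite triangle_waveE //; lia.
Qed.

Lemma triangle_wave_step M (z : int) : (0 < M)%N ->
  triangle_wave M (z + 1) = (triangle_wave M z).+1 \/
  triangle_wave M z = (triangle_wave M (z + 1)).+1.
Proof.
move=> M0; have [q [k [-> k1 k2]]] := triangle_wave_mod z M0.
by rewrite -addrA !triangle_waveE //; lia.
Qed.

(* The mirrors of the triangle wave are placed so that both intervals fall between two consecutive mirrors. *)
Lemma fold_line n (a a' : int) : (0 < n)%N ->
  exists (phi : int -> nat) (s s' : nat -> int),
  [/\ forall i, (phi i <= n.*2)%N,
      forall i, phi (i + 1) = (phi i).+1 \/ phi i = (phi (i + 1)).+1,
      forall k, `|s k.+1 - s k| = 1 :> int /\ `|s' k.+1 - s' k| = 1 :> int,
      forall i, a <= i -> i < a + n%:Z -> s (phi i) = i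
    & forall i, a' <= i -> i < a' + n%:Z -> s' (phi i) = i].
Proof.
move=> n0; have [M ME] : exists M, M = n.*2 by eexists.
have M0 : (0 < M)%N by lia.
(* The mirrors are [c] plus the multiples of [M]. They are aligned on [a], unless a mirror would
   then cut the second interval; in that case they are aligned on [a']. *)
have [c [q [r [ca1 ca2 a'E r1 r2]]]] : exists c q r : int,
    [/\ c <= a, a <= c + n%:Z, a' = c + q * M%:Z + r, 0 <= r & r <= n%:Z].
  have d0 : M%:Z != 0 :> int by lia.
  have := divz_eq (a' - a) M%:Z.
  have := modz_ge0 (a' - a) d0; have := ltz_mod (a' - a) d0.
  move: (_ %% _)%Z (_ %/ _)%Z => r q rM r0 a'E.
  have [rn|rn] := boolP (r <= n%:Z).
    by exists a, q, r; split; lia.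
  exists (a + r - M%:Z), (q + 1), 0; rewrite mulrDl mul1r.
  by split; lia.
pose phi i := triangle_wave M (i - c).
have phi_id i : c <= i -> i <= c + M%:Z -> (phi i)%:Z = i - c.
  move=> i1 i2; rewrite /phi -[i - c]add0r -[X in triangle_wave _ (X + _)](mul0r M.*2%:Z).
  by rewrite triangle_waveE //; lia.
have [p qp] : exists p : int, q = p * 2 \/ q = p * 2 - 1.
  by exists ((q + 1) %/ 2)%Z; lia.
pose s k := c + k%:Z.
(* Over the second interval the wave rises if [q] is even and falls if [q] is odd, so [s'] runs
   forward or backward. *)
pose s' k := if q == p * 2 then c + q * M%:Z + k%:Z else c + (q + 1) * M%:Z - k%:Z.
exists phi, s, s'; split.
- by move=> i; rewrite -ME; exact: (triangle_wave_le (i - c) M0).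
- by move=> i; rewrite /phi addrAC; apply: triangle_wave_step.
- by move=> k; rewrite /s /s'; case: ifP; lia.
- by move=> i ai ia; rewrite /s phi_id; lia.
move=> i ai ia; rewrite /s' /phi.
have [qE|qE] := eqVneq q (p * 2).
  have -> : i - c = p * M.*2%:Z + (i - c - q * M%:Z).
    by rewrite -(mul2n M) PoszM mulrA -qE; lia.
  by rewrite triangle_waveE //; lia.
have qE' : q + 1 = p * 2 by lia.
have -> : i - c = p * M.*2%:Z + (i - c - (q + 1) * M%:Z).
  by rewrite -(mul2n M) PoszM mulrA -qE'; lia.
by rewrite triangle_waveE // mulrDl mul1r; lia.
Qed.

End Interpolation.

(** * Gluing blocks *)

Section Configurations.
Local Open Scope classical_set_scope.
Local Open Scope ring_scope.
Variable G : fin_graph.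
Implicit Types x y : Z2 -> G.

Lemma hom_shiftP x : hom_shift G x <->
  forall i j : int, edge (x (i, j)) (x (i + 1, j)) /\ edge (x (i, j)) (x (i, j + 1)).
Proof.
split=> [hx i j|hx [i j] [i' j']].
  by split; apply: hx; rewrite /norm1 /=; lia.
rewrite /norm1 /= => h.
have [|[|[]]] : (i' = i + 1 /\ j' = j) \/ (i = i' + 1 /\ j' = j) \/
  (i' = i /\ j' = j + 1) \/ (i' = i /\ j = j' + 1) by lia.
- by case=> -> ->; case: (hx i j).
- by case=> -> ->; rewrite edge_sym; case: (hx i' j).
- by case=> -> ->; case: (hx i j).
- by case=> -> ->; rewrite edge_sym; case: (hx i j').
Qed.

Definition glues theta (A B : Z2 -> Prop) x x' := exists y v,
  [/\ hom_shift G y, (norm_inf v < theta)%N, forall z, A z -> y z = x z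
    & forall z, B z -> y (z + v) = x' z].

Lemma glues_sub theta (A B A' B' : Z2 -> Prop) x x' :
  (forall z, A z -> A' z) -> (forall z, B z -> B' z) ->
  glues theta A' B' x x' -> glues theta A B x x'.
Proof.
move=> AA BB [y [v [hy hv yA yB]]]; exists y, v; split=> // z ?.
  exact/yA/AA.
exact/yB/BB.
Qed.

Lemma glues_symmetry theta (A B : Z2 -> Prop) x x' (s : Z2 -> Z2) :
  involutive s -> {morph s : u v / u + v} -> (forall u, norm1 (s u) = norm1 u) ->
  (forall u, norm_inf (s u) = norm_inf u) ->
  (hom_shift G (x \o s) -> hom_shift G (x' \o s) ->
   glues theta (A \o s) (B \o s) (x \o s) (x' \o s)) ->
  hom_shift G x -> hom_shift G x' -> glues theta A B x x'.
Proof.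
move=> sK sD s1 sinf.
have sB u v : s (u - v) = s u - s v.
  by apply/eqP; rewrite eq_sym subr_eq -sD subrK.
have hs y : hom_shift G y -> hom_shift G (y \o s).
  by move=> hy u v uv; apply: hy; rewrite -sB s1.
move=> h /hs hx /hs hx'; have [y [v [hy hv yA yB]]] := h hx hx'.
exists (y \o s), (s v); split; [exact: hs | by rewrite sinf | |] => z hz /=.
  by rewrite yA /= ?sK.
by rewrite sD sK yB /= ?sK.
Qed.

Definition column_range (a : int) n (z : Z2) := a <= z.1 /\ z.1 < a + n%:Z.

(** Columns are folded by [phi], so only positions 0 to [2 * n] of each row are read and truncated
    rows suffice. The rows [r] are those of [x] up to [b], then an interpolation, then those of [x']
    raised by [j]. *)
Lemma glue_vertically theta N T n x x' (a a' b b' : int) : (0 < n)%N ->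
  spread G theta N -> collapses G T n.*2 -> b + (T.*2 + N).+1%:Z <= b' ->
  hom_shift G x -> hom_shift G x' ->
  glues theta (fun z => column_range a n z /\ z.2 <= b)
    (fun z => column_range a' n z /\ b' <= z.2) x x'.
Proof.
move=> n0 sp cT bb hx hx'.
have [phi [s [s' [phi_le phi_step s_step sphi sphi']]]] := fold_line a a' n0.
have M0 : (0 < n.*2)%N by lia.
have wx j : is_walk (fun k => x (s k, j)).
  by move=> k; apply: hx; rewrite /norm1 /=; case: (s_step k); lia.
have wx' j : is_walk (fun k => x' (s' k, j)).
  by move=> k; apply: hx'; rewrite /norm1 /=; case: (s_step k); lia.
have [|j jt] := @interpolation _ theta N T _ _ _ (absz (b' - b)) sp cT M0 (wx b) (wx' b').
  by lia.
set D := (_ + j)%N => rows; have [R [R0 RD RR]] := iter_rel_fun rows.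
have DE : D%:Z = b' - b + j%:Z by rewrite /D; lia.
have wR t : (t <= D)%N -> is_walk (R t).
  case: t => [_|t tD]; last by case: (RR t tD).
  by rewrite R0; apply: osc_walk_walk => // i _; apply: wx.
have R0E k : (k <= n.*2)%N -> R 0%N k = x (s k, b) by rewrite R0 /osc_walk => ->.
have RDE k : (k <= n.*2)%N -> R D k = x' (s' k, b') by rewrite RD /osc_walk => ->.
pose r (i : int) := if i <= b then fun k => x (s k, i)
  else if i <= b + D%:Z then R (absz (i - b)) else fun k => x' (s' k, i - j%:Z).
have wr i : is_walk (r i).
  by rewrite /r; case: ifP => // ?; case: ifP => // ?; apply: wR; lia.
have rr i k : (k <= n.*2)%N -> edge (r i k) (r (i + 1) k).
  move=> kn; rewrite /r; case c1: (i <= b); case c2: (i + 1 <= b).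
  - by apply: hx; rewrite /norm1 /=; lia.
  - have -> : i = b by lia.
    rewrite ifT; last by lia.
    rewrite -R0E // (_ : absz (b + 1 - b)%R = 1%N); last by lia.
    by case: (RR 0%N) => //; lia.
  - by lia.
  case c3: (i <= b + D%:Z); case c4: (i + 1 <= b + D%:Z).
  - rewrite (_ : absz (i + 1 - b)%R = (absz (i - b)%R).+1); last by lia.
    by case: (RR (absz (i - b)%R)) => //; lia.
  - have -> : i = b + D%:Z by lia.
    rewrite (_ : absz (b + D%:Z - b)%R = D) ?RDE //; last by lia.
    by apply: hx'; rewrite /norm1 /=; lia.
  - by lia.
  - by apply: hx'; rewrite /norm1 /=; lia.
exists (fun z => r z.2 (phi z.1)), (0, j%:Z); split.
- apply/hom_shiftP => i l /=; split; last exact: rr.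
  by case: (phi_step i) => ->; [|rewrite edge_sym]; apply: wr.
- by rewrite /norm_inf /=; lia.
- by case=> i l [[/= i1 i2] lb]; rewrite /r lb sphi.
case=> i l [[/= i1 i2] lb]; rewrite /r addr0.
rewrite ifF; last by lia.
case: ifP => c; last by rewrite addrK sphi'.
have lE : l = b' by lia.
by rewrite (_ : absz (l + j%:Z - b)%R = D) ?RDE ?sphi' ?lE //; lia.
Qed.

Definition box (u : Z2) n (z : Z2) :=
  column_range u.1 n z /\ (u.2 <= z.2 /\ z.2 < u.2 + n%:Z).

(** The lower block ends at row [u.2 + n - 1], whence the [+ 1]. *)
Definition separated (d n : nat) (u u' : Z2) := u.2 + n%:Z + d%:Z <= u'.2 + 1.

Lemma glue_boxes theta N T n x x' (u u' : Z2) (d := (T.*2 + N).+1) : (0 < n)%N ->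
  spread G theta N -> collapses G T n.*2 ->
  [\/ separated d n u u', separated d n u' u,
      separated d n (u.2, u.1) (u'.2, u'.1) | separated d n (u'.2, u'.1) (u.2, u.1)] ->
  hom_shift G x -> hom_shift G x' -> glues theta (box u n) (box u' n) x x'.
Proof.
move: u u' => [u1 u2] [v1 v2]; rewrite /separated /= => n0 sp cT h.
(* The offset of the last row or column of a box, which becomes the first one under a reflection. *)
pose e : int := n%:Z - 1.
case: h => h.
- move=> hx hx'.
  apply: glues_sub (glue_vertically u1 v1 (b := u2 + e) (b' := v2) n0 sp cT _ hx hx').
  + by move=> z [? []] /=; split=> //; rewrite /e; lia.
  + by move=> z [? []] /=; split.
  + by rewrite /e; lia.
- apply: (@glues_symmetry _ _ _ _ _ (fun z => (z.1, - z.2))).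
  + by case=> i j /=; rewrite opprK.
  + by move=> [i j] [k l] /=; congr pair; rewrite /= opprD.
  + by case=> i j; rewrite /norm1 /=; lia.
  + by case=> i j; rewrite /norm_inf /=; lia.
  move=> hx hx'.
  apply: glues_sub (glue_vertically u1 v1 (b := - u2) (b' := - v2 - e) n0 sp cT _ hx hx').
  + by move=> z [? []] /=; split=> //; lia.
  + by move=> z [? []] /=; split=> //; rewrite /e; lia.
  + by rewrite /e; lia.
- apply: (@glues_symmetry _ _ _ _ _ (fun z => (z.2, z.1))).
  + by case.
  + by [].
  + by case=> i j; rewrite /norm1 /=; lia.
  + by case=> i j; rewrite /norm_inf /=; lia.
  move=> hx hx'.
  apply: glues_sub (glue_vertically u2 v2 (b := u1 + e) (b' := v1) n0 sp cT _ hx hx').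
  + by move=> z [[/= ? ?] []] /=; split=> //; rewrite /e; lia.
  + by move=> z [[/= ? ?] []] /=; split.
  + by rewrite /e; lia.
- apply: (@glues_symmetry _ _ _ _ _ (fun z => (- z.2, - z.1))).
  + by case=> i j /=; rewrite !opprK.
  + by move=> [i j] [k l] /=; congr pair; rewrite /= opprD.
  + by case=> i j; rewrite /norm1 /=; lia.
  + by case=> i j; rewrite /norm_inf /=; lia.
  move=> hx hx'.
  apply: glues_sub
    (glue_vertically (- u2 - e) (- v2 - e) (b := - u1) (b' := - v1 - e) n0 sp cT _ hx hx').
  + by move=> z [[/= ? ?] []] /=; split=> //; try split; rewrite /e /=; lia.
  + by move=> z [[/= ? ?] []] /=; split=> //; try split; rewrite /e /=; lia.
  + by rewrite /e; lia.
Qed.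

(** If neither coordinate separates the blocks, [close] picks, one coordinate at a time, a cell in
    each with distance less than [d]. *)
Lemma delta_separated n d (u u' : Z2) : (0 < n)%N -> (0 < d)%N ->
  (d <= delta (block n u) (block n u'))%N ->
  [\/ separated d n u u', separated d n u' u,
      separated d n (u.2, u.1) (u'.2, u'.1) | separated d n (u'.2, u'.1) (u.2, u.1)].
Proof.
move=> n0 d0; rewrite /separated /=.
have close (i j : int) : ~ i + n%:Z + d%:Z <= j + 1 -> ~ j + n%:Z + d%:Z <= i + 1 ->
    exists k l : 'I_n, (absz ((i + k%:Z) - (j + l%:Z))%R < d)%N.
  move=> h1 h2; have [ij|ji] := leP i j.
    have kn : (minn (absz (j - i)%R) n.-1 < n)%N by lia.
    by exists (Ordinal kn), (Ordinal n0) => /=; lia.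
  have kn : (minn (absz (i - j)%R) n.-1 < n)%N by lia.
  by exists (Ordinal n0), (Ordinal kn) => /=; lia.
move=> le; apply: contrapT => h.
have [||k1 [l1 c1]] := close u.1 u'.1.
- by move=> ?; apply: h; apply: Or43.
- by move=> ?; apply: h; apply: Or44.
have [||k2 [l2 c2]] := close u.2 u'.2.
- by move=> ?; apply: h; apply: Or41.
- by move=> ?; apply: h; apply: Or42.
set P := [set norm_inf (w - w') | w in block n u & w' in block n u'].
have Pin : P (norm_inf ((u + cell (k1, k2)) - (u' + cell (l1, l2)))).
  exists (u + cell (k1, k2)); first by exists (k1, k2).
  by exists (u' + cell (l1, l2)) => //; exists (l1, l2).
have [_ /(_ _ Pin)] : P (nat_min P) /\ forall m, P m -> (nat_min P <= m)%N.
  by apply: nat_minP; eexists; exact: Pin.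
move: le; rewrite /delta -/P; move: (nat_min P) => m dm.
by rewrite leqNgt (leq_trans _ dm) // /norm_inf gtn_max /= c1 c2.
Qed.

(** [phased_block_gluing] at one size: sizes are independent, so the minimal gap function is
    obtained pointwise. *)
Definition glues_at theta n d := forall p p' : pattern G n,
  globally_admissible (hom_shift G) p -> globally_admissible (hom_shift G) p' ->
  forall u u' : Z2, (d <= delta (block n u) (block n u'))%N ->
  exists x v, [/\ hom_shift G x, (norm_inf v < theta)%N, appears_at p x u
                & appears_at p' x (u' + v)].

Lemma hom_shift_translate x t : hom_shift G x -> hom_shift G (fun z => x (z + t)).
Proof. by move=> hx u v uv; apply: hx; rewrite opprD addrACA subrr addr0. Qed.

Lemma glues_at_collapse theta N T n : (0 < n)%N -> spread G theta N ->
  collapses G T n.*2 -> glues_at theta n (T.*2 + N).+1.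
Proof.
move=> n0 sp cT p p' [x [t [hx xp]]] [x' [t' [hx' xp']]] u u' /(delta_separated n0) sep.
have [y [v [hy hv yA yB]]] := glue_boxes n0 sp cT (sep isT)
  (hom_shift_translate (t - u) hx) (hom_shift_translate (t' - u') hx').
have in_box w (i : 'I_n * 'I_n) : box w n (w + cell i).
  by case: i => [[i ?] [j ?]]; split=> /=; [rewrite /column_range /=|]; lia.
have shiftK (w s c : Z2) : w + c + (s - w) = s + c by rewrite addrAC [w + _]addrC subrK.
exists y, v; split=> // i; first by rewrite yA // -xp shiftK.
by rewrite addrAC yB // -xp' shiftK.
Qed.

End Configurations.

(** * Phase and linear lower bound *)

Section Phase.
Variable G : fin_graph.
Implicit Types (a b c : G) (w : nat -> G) (x : Z2 -> G).

Definition alternate a b (i : nat) : G := if odd i then b else a.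

Lemma alternate_walk a b : edge a b -> is_walk (alternate a b).
Proof. by move=> ab i; rewrite /alternate /=; case: odd; rewrite //= edge_sym. Qed.

Lemma walk_between_cons l a b c : edge a c -> walk_between l c b ->
  walk_between l.+1 a b.
Proof.
move=> ac [g [wg g0 gl]]; exists (fun i => if i is j.+1 then g j else a); split=> //.
by case=> [|i] //=; rewrite g0.
Qed.

Lemma walk_between_refl k a b : edge a b -> walk_between k.*2 a a.
Proof.
move=> ab; exists (alternate a b); split; [exact: alternate_walk | by [] |].
by rewrite /alternate odd_double.
Qed.

(** A path prolonged by an alternation has any larger length of its parity, and [m] or [m + 1] has
    that parity. *)
Lemma spread2 : (forall a, exists b, edge a b) -> exists N, spread G 2 N.
Proof.
move=> nb.
pose Q (ab : G * G) N := forall m, N <= m ->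
  exists2 j, j < 2 & walk_between (m + j) ab.1 ab.2.
have [|[a b]|N NQ] := @uniform_bound _ Q; last by exists N => a b; apply: (NQ (a, b)).
  by move=> t m n mn Qm k nk; apply: Qm; apply: leq_trans nk.
have /connectP[p] := edge_connected a b.
have path_walk k : path (@edge G) a p -> b = last a p -> walk_between (size p + k.*2) a b.
  elim: p a => [|c p IH] a /=; last first.
    by case/andP=> ac pc bE; rewrite addSn; apply: walk_between_cons ac (IH _ pc bE).
  by move=> _ ->; have [c ac] := nb a; apply: walk_between_refl ac.
move=> pp pe; exists (size p) => m pm.
exists (odd (m - size p)); first by case: odd.
have -> : m + odd (m - size p) = size p + (uphalf (m - size p)).*2 by lia.
exact: path_walk.
Qed.

(** For [0 < n] the blocks are nonempty, so [delta] is an attained minimum and not the default 0. *)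
Lemma le_delta n d (u u' : Z2) : 0 < n ->
  (forall k l : 'I_n * 'I_n, d <= norm_inf ((u + cell k) - (u' + cell l))%R) ->
  d <= delta (block n u) (block n u').
Proof.
move=> n0 h; rewrite /delta; set P := [set _ | _ in _ & _ in _]%classic.
have [[_ [k _ <-] [_ [l _ <-] <-]] _] : P (nat_min P) /\ forall m, P m -> (nat_min P <= m)%N.
  apply: nat_minP; pose o : 'I_n := Ordinal n0; eexists.
  exists (u + cell (o, o))%R; first by exists (o, o).
  by exists (u' + cell (o, o))%R; first by exists (o, o).
exact: h.
Qed.

(** The walk is reflected at 0 and spread along antidiagonals. *)
Lemma diagonal_config w : is_walk w ->
  hom_shift G (fun z => w (absz (z.1 + z.2)%R)).
Proof.
move=> ww; apply/hom_shiftP => i j /=.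
have step (k : int) : edge (w (absz k)) (w (absz (k + 1)%R)).
  have [->|->] : absz (k + 1)%R = (absz k).+1 \/ absz k = (absz (k + 1)%R).+1 by lia.
    exact: ww.
  by rewrite edge_sym.
by split; [have := step (i + j)%R | have := step (i + j)%R];
  congr (edge _ (w (absz _))); lia.
Qed.

Lemma config_pattern x (u : Z2) n : hom_shift G x ->
  exists2 p : pattern G n, globally_admissible (hom_shift G) p & appears_at p x u.
Proof.
move=> hx; exists [ffun i => x (u + cell i)%R]; last by move=> i; rewrite ffunE.
by exists x, u; split=> // i; rewrite ffunE.
Qed.

(** The blocks are stacked, and rows are read from the top of the lower to the bottom of the upper
    one. Reading starts at column [theta], to stay inside the upper block whatever its shift; hence
    the loss of [2 * theta]. *)
Lemma glues_at_rows theta n d w w' : 0 < n -> 0 < theta -> glues_at G theta n d ->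
  is_walk w -> is_walk w' -> exists (D c : nat) (R : nat -> nat -> G),
  [/\ D <= d + theta.*2, forall t, adjacent_walks (R t) (R t.+1),
      forall i, i + theta.*2 <= n -> R 0 i = w i
    & forall i, i + theta.*2 <= n -> R D i = w' (i + c)].
Proof.
move=> n0 t0 hn ww ww'.
(* With this corner, the top row of [p] spells [w] from column [theta] on. *)
have [p pX px] := config_pattern (- theta%:Z, - n.-1%:Z)%R n (diagonal_config ww).
have [p' pX' px'] := config_pattern 0%R n (diagonal_config ww').
(* The extra [theta] keeps the upper block above the lower one after a shift by [v2 > - theta]. *)
pose H := (n.-1 + d + theta)%N.
have [|y [v [hy hv yp yp']]] := hn p p' pX pX' 0%R (0, H%:Z)%R.
  apply: le_delta => // -[[k1 ?] [k2 ?]] [[l1 ?] [l2 ?]].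
  by rewrite /norm_inf /cell /H /=; lia.
case: v hv yp' => v1 v2; rewrite /norm_inf /= => hv yp'.
exists (absz (d%:Z + theta%:Z + v2)%R), (absz (theta%:Z - v1)%R).
exists (fun t i => y (theta%:Z + i%:Z, n.-1%:Z + t%:Z)%R).
have wy t : is_walk (fun i => y (theta%:Z + i%:Z, n.-1%:Z + t%:Z)%R).
  by move=> i; apply: hy; rewrite /norm1 /=; lia.
split.
- lia.
- by move=> t; split=> // i; apply: hy; rewrite /norm1 /=; lia.
- move=> i it.
  have i1 : theta + i < n by lia.
  have i2 : n.-1 < n by lia.
  have := yp (Ordinal i1, Ordinal i2); rewrite -px /cell /= add0r => E.
  have -> : (theta%:Z + i%:Z, n.-1%:Z + 0%:Z)%R = (Posz (theta + i), Posz n.-1).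
    by congr pair; lia.
  by rewrite E; congr w; lia.
move=> i it.
have i1 : absz (theta%:Z + i%:Z - v1)%R < n by lia.
have := yp' (Ordinal i1, Ordinal n0); rewrite -px' /cell /= => E.
rewrite (_ : (_, _) = ((0, H%:Z) + (v1, v2) + (Posz (absz (theta%:Z + i%:Z - v1)%R), Posz 0))%R).
  by rewrite E; congr w'; lia.
by congr pair; rewrite /H /=; lia.
Qed.

(** Gluing single vertices at height [m] without shift makes the column between them a walk of
    length exactly [m]. *)
Lemma spread1 f : (forall a, exists b, edge a b) ->
  phased_block_gluing (hom_shift G) f 1 -> exists N, spread G 1 N.
Proof.
move=> nb hf; exists (f 1) => a b m fm; exists 0 => //; rewrite addn0.
have [[a' aa'] [b' bb']] := (nb a, nb b).
have [p pX px] := config_pattern 0%R 1 (diagonal_config (alternate_walk aa')).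
have [p' pX' px'] := config_pattern 0%R 1 (diagonal_config (alternate_walk bb')).
have [||y [[v1 v2] [hy hv yp yp']]] := hf 1 _ p p' pX pX' 0%R (0, m%:Z)%R => //.
  apply: le_delta => // -[[k1 ?] [k2 ?]] [[l1 ?] [l2 ?]].
  by rewrite /norm_inf /cell /=; lia.
rewrite /norm_inf /= in hv.
exists (fun t => y (0, t%:Z)%R); split.
- by move=> t; apply: hy; rewrite /norm1 /=; lia.
- by have := yp (ord0, ord0); rewrite -px.
have := yp' (ord0, ord0); rewrite -px' /alternate /= => <-; congr y.
by congr pair; rewrite /=; lia.
Qed.

Lemma neighbor_exists x a : hom_shift G x -> exists b, edge a b.
Proof.
move=> hx; have /connectP[p] := edge_connected a (x (0, 0)%R).
case: p => [_ /= <-|b p /= /andP[ab _] _]; last by exists b.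
by exists (x (1, 0)%R); apply: hx.
Qed.

Lemma glues_at_linear theta N n : 0 < n -> spread G theta N ->
  glues_at G theta n (n.*2.*2 + N).+1.
Proof.
move=> n0 sp; apply: (glues_at_collapse (T := n.*2) n0 sp).
by apply: collapses_linear; lia.
Qed.

(** The phase is 1 if some gap function works without shift, and 2 otherwise, by [spread2]. *)
Lemma phase_exists x : hom_shift G x ->
  exists theta N, is_phase (hom_shift G) theta /\ spread G theta N.
Proof.
move=> hx; have nb a : exists b, edge a b := neighbor_exists a hx.
have phasedP theta N : spread G theta N ->
    exists f, phased_block_gluing (hom_shift G) f theta.
  by move=> sp; exists (fun n => (n.*2.*2 + N).+1) => n n0; apply: glues_at_linear.
have [[f h1]|n1] := pselect (exists f, phased_block_gluing (hom_shift G) f 1).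
  have [N sp] := spread1 nb h1; exists 1, N; split=> //; split=> //.
  exact: phasedP sp.
have [N sp] := spread2 nb; exists 2, N; split=> //; split=> //; first exact: phasedP sp.
move=> [|[|k]] // f _ hf; case: n1; by exists f.
Qed.

Lemma gamma_exists theta : is_phase (hom_shift G) theta -> exists gamma,
  [/\ is_gamma (hom_shift G) gamma, forall n, 0 < n -> glues_at G theta n (gamma n)
    & forall n d, 0 < n -> glues_at G theta n d -> gamma n <= d].
Proof.
move=> ph; have [_ [f hf] _] := ph.
pose gamma n := nat_min (glues_at G theta n).
have gammaP n : 0 < n -> glues_at G theta n (gamma n) /\
    forall d, glues_at G theta n d -> gamma n <= d.
  by move=> n0; apply: nat_minP; exists (f n) => p p'; apply: hf.
exists gamma; split.
- exists theta; split=> //.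
    by move=> n n0; case: (gammaP n n0).
  by move=> g hg n n0; case: (gammaP n n0) => _; apply; apply: hg.
- by move=> n n0; case: (gammaP n n0).
by move=> n d n0; case: (gammaP n n0) => _; apply.
Qed.

End Phase.

(** * Linear lower bound from words that cannot be shortened *)

Section LinearLowerBound.
Variable G : fin_graph.
Implicit Types (a b c : G) (w : nat -> G) (s r : seq G).
Hypothesis nb : forall a, exists b, edge a b.

Lemma homotopic_pad r k : r != [::] ->
  exists2 r', size r' = size r + k.*2 & homotopic r r'.
Proof.
elim: k r => [|k IH] r r0; first by exists r; [rewrite addn0 | exact: Homotopic_refl].
case: r r0 => // a r _; have [b ab] := nb a.
have [r' sr' hr'] := IH [:: a, b, a & r] isT.
exists r'; first by rewrite sr' /=; lia.
exact: Homotopic_trans (Homotopic_back [::] r ab) hr'.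
Qed.

(** Homotopy preserves the parity of the length, so a shorter word could be padded by backtracks to
    exactly [L + 1] letters. *)
Lemma homotopic_size_gt L s r : size s = L.+3 ->
  (forall r', size r' = L.+1 -> ~ homotopic s r') -> homotopic s r -> L.+1 < size r.
Proof.
move=> sL hs sr; rewrite ltnNge; apply/negP => le.
have r0 : r != [::] by rewrite -(homotopic_nil sr) -size_eq0 sL.
have /esym := homotopic_odd_size sr; rewrite sL /= => od.
have [r' sr' rr'] := homotopic_pad (L.+1 - size r)./2 r0.
apply: (hs r'); last exact: Homotopic_trans rr'.
by rewrite sr'; lia.
Qed.

Lemma mkseqSr (T : Type) (f : nat -> T) n : mkseq f n.+1 = rcons (mkseq f n) (f n).
Proof. by rewrite /mkseq -addn1 iotaD map_cat cats1. Qed.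

(** The vertical edge on the right is pushed across one square at a time. *)
Lemma homotopic_rows w w' m : adjacent_walks w w' ->
  homotopic (mkseq w m.+1) (w 0 :: mkseq w' m.+1 ++ [:: w m]).
Proof.
case=> ww ww' e; elim: m => [|m IH]; first exact: (Homotopic_back [::] [::] (e 0)).
rewrite mkseqSr -cats1.
apply: Homotopic_trans (homotopic_ctx [::] [:: w m.+1] IH) _.
rewrite (mkseqSr w' m.+1) (mkseqSr w' m) -!cats1 /= -!catA /= -!cat_cons.
by apply: Homotopic_square; rewrite // edge_sym.
Qed.

Lemma homotopic_grid (R : nat -> nat -> G) m D :
  (forall t, adjacent_walks (R t) (R t.+1)) ->
  exists l r, [/\ size l = D, size r = D &
    homotopic (mkseq (R 0) m.+1) (l ++ mkseq (R D) m.+1 ++ r)].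
Proof.
move=> hR; elim: D => [|D [l [r [sl sr h]]]].
  by exists [::], [::]; rewrite cats0; split=> //; apply: Homotopic_refl.
exists (l ++ [:: R D 0]), ([:: R D m] ++ r); split.
- by rewrite size_cat sl addn1.
- by rewrite size_cat sr.
apply: Homotopic_trans h _.
have := homotopic_ctx l r (homotopic_rows m (hR D)).
by rewrite -!catA /= -catA.
Qed.

Lemma homotopic_alternating w m : is_walk w -> (forall i, i.+2 <= m -> w i.+2 = w i) ->
  exists2 r, size r <= 2 & homotopic (mkseq w m.+1) r.
Proof.
move=> ww; elim/ltn_ind: m => m IH ow.
case: m IH ow => [|[|m]] IH ow.
- by exists (mkseq w 1) => //; apply: Homotopic_refl.
- by exists (mkseq w 2) => //; apply: Homotopic_refl.
have [||r sr hr] := IH m; first by lia.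
  by move=> i im; apply: ow; lia.
exists r => //; apply: Homotopic_trans hr.
rewrite (mkseqSr _ m.+2) (mkseqSr _ m.+1) (mkseqSr _ m) -!cats1 -!catA /= ow //.
by apply: Homotopic_sym; apply: Homotopic_back.
Qed.

Lemma glues_at_ge_linear theta n d : (forall L, ~ contractible G L) ->
  0 < n -> 0 < theta -> glues_at G theta n d -> n <= d.*2 + 6 * theta + 4.
Proof.
move=> nc n0 t0 hd; have [//|ln] := leqP n (d.*2 + 6 * theta + 4).
(* The [L + 3] letters fill exactly the positions that [glues_at_rows] prescribes. *)
pose L := n - theta.*2 - 3.
have [w ww hw] : exists2 w : nat -> G, is_walk w &
    forall r, size r = L.+1 -> ~ homotopic (mkseq w L.+3) r.
  apply: contrapT => h; apply: (nc L) => w ww; apply: contrapT => h'.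
  by apply: h; exists w => // r sr wr; apply: h'; exists r.
have [b ab] := nb (w 0).
have [D [c [R [DE hR R0 RD]]]] := glues_at_rows n0 t0 hd ww (alternate_walk ab).
have [l [r [sl sr h]]] := homotopic_grid L.+2 D hR.
have wRD : is_walk (R D) by case: (hR D).
have [|q sq hq] := @homotopic_alternating (R D) L.+2 wRD.
  move=> i iL; rewrite !RD; try by rewrite /L in iL; lia.
  by rewrite /alternate /= negbK.
have E : mkseq (R 0) L.+3 = mkseq w L.+3.
  by apply/eq_in_map => i; rewrite mem_iota => /andP[_ iL]; apply: R0; rewrite /L in iL; lia.
rewrite E in h.
have := homotopic_size_gt (size_mkseq _ _) hw (Homotopic_trans h (homotopic_ctx l r hq)).
by rewrite !size_cat sl sr /L; lia.
Qed.

End LinearLowerBound.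

(** * The spindle *)

Section Spindle.

(** Vertices as plain data, so that statements about all squares are decided by computation: [None]
    is [o], and the boolean tells [c_i] from [e_i]. *)
Definition code := option (bool * nat).

Definition code_edge (u v : code) : bool :=
  match u, v with
  | None, None => true
  | None, Some (b, _) | Some (b, _), None => ~~ b
  | Some (false, i), Some (false, j) => i == j
  | Some (true, i), Some (true, j) => (j == i.+1 %% 5) || (i == j.+1 %% 5)
  | Some (true, i), Some (false, j) | Some (false, j), Some (true, i) =>
      (i == j) || (i == j.+1 %% 5)
  end.

(* Twice the angle form around the cycle: closed on the squares through an edge of the cycle, where it has its maximal value 2. *)
Definition code_form (u v : code) : int :=
  match u, v with
  | Some (true, i), Some (true, j) =>
      if (j == i.+1 %% 5)%N then 2 else if (i == j.+1 %% 5)%N then - 2 else 0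
  | Some (true, i), Some (false, j) => if i == j then 1 else - 1
  | Some (false, j), Some (true, i) => if i == j then - 1 else 1
  | _, _ => 0
  end%R.

Definition codes : seq code :=
  None :: [seq Some (true, i) | i <- iota 0 5] ++ [seq Some (false, i) | i <- iota 0 5].

(** On a forward edge of the cycle the right side is 0: the circulation around the square is not
    positive. Otherwise it is at least 8, the trivial bound for four values of size at most 2. *)
Lemma code_form_square :
  all (fun a => all (fun b => code_edge a b ==> all (fun c => code_edge b c ==>
    all (fun d => code_edge c d && code_edge d a ==>
      (code_form a b + code_form b c - code_form d c - code_form a d
         <= 8 * (2 - code_form a b))%R) codes) codes) codes) codes.
Proof. by vm_compute. Qed.

Lemma code_form_bound u v : (- 2 <= code_form u v <= 2)%R.
Proof.
by case: u v => [[[] i]|] [[[] j]|] //=; repeat case: ifP => //.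
Qed.

Definition spindle_vertex : finType := option (bool * 'I_5).
Implicit Types u v : spindle_vertex.

Definition encode u : code := if u is Some (b, i) then Some (b, nat_of_ord i) else None.

Lemma encode_codes u : encode u \in codes.
Proof.
by case: u => [[[] [[|[|[|[|[|i]]]]] i5]]|].
Qed.

Definition spindle_edge u v := code_edge (encode u) (encode v).

Lemma spindle_sym : symmetric spindle_edge.
Proof.
by case=> [[[] i]|] [[[] j]|]; rewrite /spindle_edge //= 1?[_ == _ :> nat]eq_sym // orbC.
Qed.

Lemma spindle_connected u v : connect spindle_edge u v.
Proof.
have to_tip w : connect spindle_edge w None.
  case: w => [[[] i]|]; [|exact: connect1|exact: connect0].
  apply: (connect_trans (y := Some (false, i))); last exact: connect1.
  by apply: connect1; rewrite /spindle_edge /= eqxx.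
by apply: connect_trans (to_tip u) _; rewrite (sym_connect_sym spindle_sym).
Qed.

Definition spindle := FinGraph spindle_sym spindle_connected.

Let o : spindle := None.
Let e (i : 'I_5) : spindle := Some (false, i).
Let c (i : 'I_5) : spindle := Some (true, i).

Lemma spindle_square (a b d a' : spindle) s1 s2 :
  [&& edge a b, edge b d, edge a a' & edge a' d] ->
  homotopic (s1 ++ [:: a, b, d & s2]) (s1 ++ [:: a, a', d & s2]).
Proof. by case/and4P; apply: Homotopic_square. Qed.

Definition tip_word (u : spindle) : seq spindle :=
  match u with
  | None => [:: o]
  | Some (false, i) => [:: o; e i]
  | Some (true, i) => [:: o; e i; c i]
  end.

(** The contraction to [o]: [tip_word] is a chosen path from [o], and following an edge turns it
    into the path of the next vertex, up to steps along the loop at [o]. *)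
Lemma tip_word_rcons (u v : spindle) : edge u v ->
  exists k, homotopic (rcons (tip_word u) v) (nseq k o ++ tip_word v).
Proof.
have E i j : edge (e i) (c j) = (j == i :> nat) || (j == i.+1 %% 5 :> nat) by [].
have E' i j : edge (c i) (e j) = (i == j :> nat) || (i == j.+1 %% 5 :> nat) by [].
have C i j : edge (c i) (c j) = (j == i.+1 %% 5 :> nat) || (i == j.+1 %% 5 :> nat) by [].
have OE i : edge o (e i) by [].
have EO i : edge (e i) o by [].
have EE i j : edge (e i) (e j) = (i == j :> nat) by [].
(* The loop at [e i] replaces the excursion to [c j], and squares with [o] push the loop steps to
   [o]. *)
have ret i j : edge (e i) (c j) -> homotopic [:: o; e i; c j; e i] [:: o; o; o; e i].
  move=> ij; apply: Homotopic_trans (@spindle_square (e i) (c j) (e i) (e i) [:: o] [::] _) _.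
    by rewrite [edge (c j) _]edge_sym ij !EE !eqxx.
  apply: Homotopic_trans (@spindle_square o (e i) (e i) o [::] [:: e i] _) _.
    by rewrite !EE !eqxx.
  by apply: (@spindle_square o (e i) (e i) o [:: o] [::]); rewrite !EE !eqxx.
case: u v => [[[] i]|] [[[] j]|] //.
- rewrite -/(c i) -/(c j) C => /orP[h|h]; exists 1.
    apply: Homotopic_trans (@spindle_square (e i) (c i) (c j) (e i) [:: o] [::] _) _.
      by rewrite !E !EE C h !eqxx orbT.
    apply: Homotopic_trans (@spindle_square o (e i) (e i) o [::] [:: c j] _) _.
      by rewrite !EE !eqxx.
    by apply: (@spindle_square o (e i) (c j) (e j) [:: o] [::]); rewrite !E h !eqxx orbT.
  apply: Homotopic_trans (@spindle_square o (e i) (c i) (e j) [::] [:: c j] _) _.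
    by rewrite !E h !eqxx orbT.
  apply: Homotopic_trans (@spindle_square (e j) (c i) (c j) (e j) [:: o] [::] _) _.
    by rewrite !E !EE C h !eqxx !orbT.
  by apply: (@spindle_square o (e j) (e j) o [::] [:: c j]); rewrite !EE !eqxx.
- rewrite -/(c i) -/(e j) E' => /orP[/eqP/val_inj->|h]; exists 2; first by apply: ret; rewrite E eqxx.
  apply: Homotopic_trans (ret j i _); last by rewrite E h orbT.
  by apply: (@spindle_square o (e i) (c i) (e j) [::] [:: e j]); rewrite !E h !eqxx orbT.
- rewrite -/(e i) -/(c j) E => /orP[/eqP/val_inj->|h]; exists 0; first exact: Homotopic_refl.
  by apply: (@spindle_square o (e i) (c j) (e j) [::] [::]); rewrite !E h !eqxx orbT.
- rewrite -/(e i) -/(e j) EE => /eqP/val_inj->; exists 1.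
  by apply: (@spindle_square o (e j) (e j) o [::] [::]); rewrite !EE !eqxx.
- by exists 2; apply: (@spindle_square o (e i) o o [::] [::]).
- by exists 0; apply: Homotopic_refl.
- by exists 1; apply: Homotopic_refl.
Qed.

Lemma tip_word_cat (u : spindle) p : path (@edge spindle) u p ->
  exists k, homotopic (tip_word u ++ p) (nseq k o ++ tip_word (last u p)).
Proof.
elim: p u => [|v p IH] u /=; first by exists 0; rewrite cats0; apply: Homotopic_refl.
case/andP=> /tip_word_rcons[k hk] /IH[k' hk']; exists (k + k').
rewrite -cat_rcons nseqD -catA.
apply: Homotopic_trans (homotopic_ctx [::] p hk) _.
by rewrite /= -catA; have := homotopic_ctx (nseq k o) [::] hk'; rewrite !cats0.
Qed.

Lemma tip_word_nseq (u : spindle) k :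
  exists2 k', k' <= 1 & homotopic (nseq k o ++ tip_word u) (nseq k' o ++ tip_word u).
Proof.
elim/ltn_ind: k => -[|[|k]] IH; try by eexists; last exact: Homotopic_refl.
have [k' k1 h] := IH k (ltnW (ltnSn _)); exists k' => // {k1}.
apply: Homotopic_trans h; apply: Homotopic_sym.
have oo : edge o o by [].
have [r E] : exists r, nseq k o ++ tip_word u = o :: r.
  by case: k {IH} => [|k]; [case: u => [[[] i]|]; eexists | eexists].
by rewrite /= E; exact: (Homotopic_back [::] r oo).
Qed.

(** Walks are rerouted through [o]: at most 2 letters before it, 1 extra loop step and 3 letters of
    a tip word, so at most 6, which is [L + 1]. *)
Lemma spindle_contractible : contractible spindle 5.
Proof.
move=> w ww.
have nb (a : spindle) : exists b, edge a b.
  by case: a => [[[] i]|]; [exists (e i); rewrite /= /spindle_edge /= eqxx|exists o|exists o].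
pose p := mkseq (fun i => w i.+1) 7.
have sE : mkseq w 8 = w 0 :: p by [].
have pp : path (@edge spindle) (w 0) p by rewrite /p /mkseq /=; do 7?[apply/andP; split; first exact: ww].
have [k hk] := tip_word_cat pp.
have [k' k1 hk'] := tip_word_nseq (last (w 0) p) k.
have [q sq hq] : exists2 q, size q <= 2 &
    homotopic (w 0 :: p) (q ++ (tip_word (w 0) ++ p)).
  case: (w 0) => [[[] i]|].
  - exists [:: c i; e i] => //.
    have ce : edge (c i) (e i) by rewrite /= /spindle_edge /= eqxx.
    have eo : edge (e i) o by [].
    apply: Homotopic_trans (Homotopic_back [::] p ce) _.
    exact: (Homotopic_back [:: c i] (c i :: p) eo).
  - exists [:: e i] => //.
    have eo : edge (e i) o by [].
    exact: (Homotopic_back [::] p eo).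
  - by exists [::] => //; apply: Homotopic_refl.
have h : homotopic (mkseq w 8) (q ++ nseq k' o ++ tip_word (last (w 0) p)).
  rewrite sE; apply: Homotopic_trans hq _.
  have := homotopic_ctx q [::] (Homotopic_trans hk hk').
  by rewrite !cats0.
set r := q ++ _ in h.
have sr : size r <= 6.
  rewrite /r !size_cat size_nseq.
  have : size (tip_word (last (w 0) p)) <= 3 by case: last => [[[] i]|].
  lia.
have r0 : r != [::] by rewrite -(homotopic_nil h).
have /esym od := homotopic_odd_size h; rewrite size_mkseq /= in od.
have [r' sr' hr'] := homotopic_pad nb (6 - size r)./2 r0.
exists r'; last exact: Homotopic_trans hr'.
have [N NE] : exists N, size r = N by eexists.
by rewrite NE in sr od sr'; rewrite sr'; lia.
Qed.

(** * Logarithmic lower bound for the spindle *)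

Definition spindle_form (u v : spindle) : int := code_form (encode u) (encode v).

Definition defect (w : nat -> spindle) m : int :=
  (\sum_(i < m) (2 - spindle_form (w i) (w i.+1)))%R.

(** Summing [code_form_square] gives the factor [1 + 8]; the vertical terms telescope to two values
    of size at most 2, hence the 4. *)
Lemma defect_step (w w' : nat -> spindle) m : adjacent_walks w w' ->
  (defect w' m <= 9 * defect w m + 4)%R.
Proof.
case=> ww ww' ad.
have bnd u v : (- 2 <= spindle_form u v <= 2)%R by apply: code_form_bound.
have /andP[_ b0] := bnd (w 0) (w' 0); have /andP[bm _] := bnd (w m) (w' m).
suff : (defect w' m <= 9 * defect w m
    + spindle_form (w 0%N) (w' 0%N) - spindle_form (w m) (w' m))%R.
  lia.
elim: m {bm} => [|m IH]; first by rewrite /defect !big_ord0; lia.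
rewrite /defect !big_ord_recr /= -/(defect w m) -/(defect w' m).
have /allP/(_ _ (encode_codes (w m)))/allP/(_ _ (encode_codes (w m.+1))) := code_form_square.
move=> /implyP/(_ (ww m))/allP/(_ _ (encode_codes (w' m.+1)))/implyP/(_ (ad m.+1)).
move=> /allP/(_ _ (encode_codes (w' m)))/implyP.
have e1 : code_edge (encode (w' m.+1)) (encode (w' m)).
  by have := ww' m; rewrite edge_sym.
have e2 : code_edge (encode (w' m)) (encode (w m)) by have := ad m; rewrite edge_sym.
rewrite e1 e2 => /(_ isT); move: IH; rewrite /spindle_form; lia.
Qed.

Lemma spindle_glues_at theta n d : 0 < n -> 0 < theta -> glues_at spindle theta n d ->
  n <= 2 * 9 ^ (d + theta.*2) + theta.*2.
Proof.
move=> n0 t0 hd.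
have i5 i : i %% 5 < 5 by rewrite ltn_mod.
pose w i : spindle := c (Ordinal (i5 i)).
have modS i : i.+1 %% 5 = (i %% 5).+1 %% 5 by rewrite -addn1 -modnDml addn1.
have ww : is_walk w.
  by move=> i; rewrite /edge /= /spindle_edge /= modS eqxx.
have wo : is_walk (fun=> o) by [].
have [D [x [R [DE hR R0 RD]]]] := glues_at_rows n0 t0 hd ww wo.
have [//|ln] := leqP n (2 * 9 ^ (d + theta.*2) + theta.*2).
pose m := n - theta.*2.
have S0 : defect (R 0) m = 0%R.
  rewrite /defect big1 // => -[i im] _ /=.
  rewrite !R0; try by rewrite /m in im *; lia.
  by rewrite /spindle_form /= modS eqxx.
have SD : defect (R D) m = Posz m.*2.
  rewrite /defect (eq_bigr (fun=> 2%R)) => [|[i im] _ /=].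
    by rewrite sumr_const card_ord; lia.
  by rewrite !RD //; rewrite /m in im *; lia.
(* Adding 4 to the defect absorbs the additive constant of [defect_step]. *)
have St t : (defect (R t) m + 4 <= 4 * Posz (9 ^ t)%N)%R.
  elim: t => [|t IH]; first by rewrite S0.
  have := defect_step m (hR t); rewrite expnS; lia.
have := St D; rewrite SD => h.
have : 9 ^ D <= 9 ^ (d + theta.*2) by rewrite leq_exp2l.
by rewrite /m in h *; lia.
Qed.

End Spindle.

(** * Asymptotics *)

Local Open Scope ring_scope.

Section AsymptoticBounds.
Variable R : realType.

Lemma bigO_linear (g h : nat -> nat) (a b : nat) :
  (forall n, (0 < n)%N -> (g n <= a * h n + b)%N) ->
  bigO (fun n => (g n)%:R : R) (fun n => (h n)%:R).
Proof.
move=> gh; exists a.+1%:R, b.+1%:R; split=> // n n0.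
rewrite -natrM -natrD ler_nat; apply: leq_trans (gh n n0) _; lia.
Qed.

Lemma bigO_ln (g : nat -> nat) (a b : nat) :
  (forall n, (0 < n)%N -> (g n <= a * trunc_log 2 n + b)%N) ->
  bigO (fun n => (g n)%:R : R) (fun n => ln n%:R).
Proof.
move=> gh; have l2 : 0 < ln 2%:R :> R by rewrite ln_gt0 // ltr1n.
exists (a.+1%:R / ln 2%:R), b.+1%:R; split=> //; first by rewrite divr_gt0.
move=> n n0; have tn : (trunc_log 2 n)%:R * ln 2%:R <= ln n%:R :> R.
  rewrite mulr_natl -lnXn // -natrX ler_ln ?posrE ?ltr0n ?expn_gt0 // ler_nat.
  exact: trunc_logP.
have : (g n)%:R <= a.+1%:R * (trunc_log 2 n)%:R + b.+1%:R :> R.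
  by rewrite -natrM -natrD ler_nat; apply: leq_trans (gh n n0) _; lia.
move/le_trans; apply; rewrite lerD2r -mulrA ler_wpM2l // mulrC ler_pdivlMr //.
Qed.

Lemma ln_bigO (g : nat -> nat) (a b : nat) : (0 < b)%N -> (0 < a)%N ->
  (forall n, (0 < n)%N -> (n <= b * a ^ g n)%N) ->
  bigO (fun n => ln n%:R) (fun n => (g n)%:R : R).
Proof.
move=> b0 a0 gh; have lb (k : nat) : (0 < k)%N -> 0 <= ln k%:R :> R.
  by move=> k0; rewrite ln_ge0 // ler1n.
exists (ln a%:R + 1), (ln b%:R + 1); split; try by rewrite ltr_wpDl ?lb.
move=> n n0; have le : ln n%:R <= ln (b * a ^ g n)%:R :> R.
  by rewrite ler_ln ?posrE ?ltr0n ?muln_gt0 ?b0 ?expn_gt0 ?a0 // ler_nat gh.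
apply: le_trans le _; rewrite natrM lnM ?posrE ?ltr0n ?expn_gt0 ?a0 //.
rewrite natrX lnXn ?ltr0n // -mulr_natr mulrDl mul1r.
have := ler0n R (g n); lra.
Qed.

End AsymptoticBounds.

(** Without configurations no pattern is admissible, so gluing holds vacuously and the phase is
    1. *)
Lemma empty_gamma (G : fin_graph) : ~ (exists x, hom_shift G x) ->
  is_gamma (hom_shift G) (fun=> 0%N).
Proof.
move=> nx; have ph f k : phased_block_gluing (hom_shift G) f k.
  by move=> n n0 p p' [x [u [hx _]]]; case: nx; exists x.
by exists 1%N; split=> //; split=> //; exists (fun=> 0%N).
Qed.

Lemma glues_at_log (G : fin_graph) theta N L : spread G theta N -> contractible G L ->
  exists a b, forall n, (0 < n)%N -> glues_at G theta n (a * trunc_log 2 n + b).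
Proof.
move=> sp /collapses_log[C [A hC]]; exists (4 * C)%N, (12 * C + A.*2 + N).+1 => n n0.
(* Folded rows have length [2 * n], at most [2 ^ (trunc_log 2 n + 2)], so [collapses_log] is used
   with this exponent. *)
have -> : (4 * C * trunc_log 2 n + (12 * C + A.*2 + N).+1 =
  (((C * (trunc_log 2 n).+3).*2 + A).*2 + N).+1)%N by lia.
apply: glues_at_collapse => //; apply: hC; first by lia.
by rewrite expnS mul2n leq_double; apply/ltnW/trunc_log_ltn.
Qed.

Theorem mainTheorem1 (R : realType) :
  (forall G : fin_graph, exists gamma : nat -> nat,
     is_gamma (hom_shift G) gamma /\
     (bigTheta (fun n => (gamma n)%:R : R) (fun n => n%:R) \/
      bigO (fun n => (gamma n)%:R : R) (fun n => ln n%:R))) /\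
  (exists K : fin_graph, exists gamma : nat -> nat,
     is_gamma (hom_shift K) gamma /\
     bigTheta (fun n => (gamma n)%:R : R) (fun n => ln n%:R)).
Proof.
split=> [G|].
  have [[x hx]|nx] := pselect (exists x, hom_shift G x); last first.
    exists (fun=> 0%N); split; first exact: empty_gamma.
    by right; apply: (@bigO_ln _ _ 0 0).
  have [theta [N [ph sp]]] := phase_exists hx.
  have [gamma [hgamma gammaP gamma_le]] := gamma_exists ph.
  exists gamma; split=> //.
  have t0 : (0 < theta)%N by case: ph.
  have [[L cL]|nL] := pselect (exists L, contractible G L).
    right; have [a [b hab]] := glues_at_log sp cL.
    by apply: (@bigO_ln _ _ a b) => n n0; apply: gamma_le => //; apply: hab.
  left; split.
    apply: (@bigO_linear _ _ id 4 N.+1) => n n0.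
    apply: leq_trans (gamma_le _ _ n0 (glues_at_linear n0 sp)) _; lia.
  apply: (@bigO_linear _ id _ 2 (6 * theta + 4)) => n n0.
  have nb a : exists b, edge a b := neighbor_exists a hx.
  have nc L : ~ contractible G L by move=> cL; apply: nL; exists L.
  have := glues_at_ge_linear nb nc n0 t0 (gammaP n n0); lia.
exists spindle.
have hx : hom_shift spindle (fun=> None) by [].
have [theta [N [ph sp]]] := phase_exists hx.
have t0 : (0 < theta)%N by case: ph.
have [gamma [hgamma gammaP gamma_le]] := gamma_exists ph.
exists gamma; split=> //; split.
  have [a [b hab]] := glues_at_log sp spindle_contractible.
  by apply: (@bigO_ln _ _ a b) => n n0; apply: gamma_le => //; apply: hab.
(* The margin [2 * theta] is constant; its power of 9 and itself go into the factor. *)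
apply: (@ln_bigO _ _ 9 (2 * 9 ^ theta.*2 + theta.*2)) => // [|n n0].
  by rewrite addn_gt0 muln_gt0 expn_gt0.
apply: leq_trans (spindle_glues_at n0 t0 (gammaP n n0)) _.
rewrite expnD mulnDl; apply: leq_add; first by rewrite -mulnA [(9 ^ theta.*2 * _)%N]mulnC.
by apply: leq_pmulr; rewrite expn_gt0.
Qed.
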